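(* Let $n\ge 3$, $p\ge \frac{n+2}{n-2}$, $1\le q<\frac{n}{n-2}$, and let $c_+>0$ be a constant. Let $H=\mathbb{R}^n_+=\{(x',t): x'\in\mathbb{R}^{n-1},\ t>0\}$. Suppose $u\in C^2(H)\cap C^1(\overline H)$ satisfies $$\Delta u=n(n-2)u^p,\quad u>0 \ \text{ in } H,\qquad \frac{\partial u}{\partial t}=-c_+u^q \ \text{ on } \partial H=\{t=0\}.$$ Then for all $(x',t)\in \overline H$, $$u(x',t)=\Big(\frac{p-1}{2}At+B\Big)^{-2/(p-1)},$$ where $A=\big(\frac{2n(n-2)}{p+1}\big)^{1/2}$ and $B=(c_+^{-1}A)^{-(p-1)/(2q-p-1)}$.
   Context: Points of $\mathbb{R}^n$ are written $x=(x',t)$ with $x'\in\mathbb{R}^{n-1}$, $t\in\mathbb{R}$; $\partial u/\partial t$ on $\partial H$ denotes the derivative in the $t$-variable at $t=0$. *)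

(* Defs.v *)
From HB Require Import structures.
From mathcomp Require Import all_boot all_order all_algebra.
From mathcomp Require Import all_classical all_reals all_analysis.
Set Implicit Arguments. Unset Strict Implicit. Unset Printing Implicit Defensive.
Import Order.TTheory GRing.Theory Num.Theory.
Import numFieldNormedType.Exports.
Local Open Scope classical_set_scope.
Local Open Scope ring_scope.

(* Points of R^n are written (x', t) with x' : 'rV[R]_k (k = n-1) and t : R.
   A function on R^n is a curried map  f : 'rV[R]_k -> R -> R.
   Coordinate directions: [Some i] = i-th coordinate of x', [None] = t. *)

Definition shift {R : realType} {k : nat} (f : 'rV[R]_k -> R -> R)
  (d : option 'I_k) (x : 'rV[R]_k) (t : R) : R -> R :=
  match d with
  | Some i => fun s => f (x + s *: delta_mx 0 i) t
  | None => fun s => f x (t + s)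
  end.

Definition partial {R : realType} {k : nat} (d : option 'I_k)
  (f : 'rV[R]_k -> R -> R) : 'rV[R]_k -> R -> R :=
  fun x t => derive1 (shift f d x t) 0.

Definition uncurry2 {R : realType} {k : nat} (f : 'rV[R]_k -> R -> R)
  : 'rV[R]_k * R -> R := fun z => f z.1 z.2.

Definition Hhalf {R : realType} (k : nat) : set ('rV[R]_k * R) := [set z | 0 < z.2].
Definition Hclos {R : realType} (k : nat) : set ('rV[R]_k * R) := [set z | 0 <= z.2].
Arguments Hhalf {R} k _.
Arguments Hclos {R} k _.

Definition C2_H {R : realType} {k : nat} (f : 'rV[R]_k -> R -> R) : Prop :=
  {within Hhalf k, continuous uncurry2 f} /\
  forall d e : option 'I_k,
    (forall x t, 0 < t ->
       derivable (shift f d x t) 0 1 /\ derivable (shift (partial d f) e x t) 0 1) /\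
    {within Hhalf k, continuous uncurry2 (partial d f)} /\
    {within Hhalf k, continuous uncurry2 (partial e (partial d f))}.

Definition C1_Hbar {R : realType} {k : nat} (f : 'rV[R]_k -> R -> R) : Prop :=
  {within Hclos k, continuous uncurry2 f} /\
  forall d : option 'I_k,
    (forall x t, 0 < t -> derivable (shift f d x t) 0 1) /\
    exists g : 'rV[R]_k -> R -> R,
      {within Hclos k, continuous uncurry2 g} /\
      (forall x t, 0 < t -> partial d f x t = g x t).

Definition laplacian {R : realType} {k : nat} (f : 'rV[R]_k -> R -> R)
  : 'rV[R]_k -> R -> R :=
  fun x t => \sum_(d : option 'I_k) partial d (partial d f) x t.

(* Main.v *)
Require Import Defs.
From HB Require Import structures.
From mathcomp Require Import all_boot all_order all_algebra.
From mathcomp Require Import all_classical all_reals all_analysis.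
From mathcomp Require Import ring lra.
Import Order.TTheory GRing.Theory Num.Theory.
Import numFieldNormedType.Exports.
Local Open Scope classical_set_scope.
Local Open Scope ring_scope.

(** The proof is by moving spheres. For a boundary centre, put [U = r ^ ((n - 2) / 2) u] and
    compare [U] with its composition with the inversion in a sphere of radius [l]. In the
    cylindrical coordinates [log r] and [y / r] this inversion is a reflection, and the Laplacian
    becomes the sum of the second derivatives along dilations and along rotations. Since
    [p >= (n + 2) / (n - 2)], the difference of the two functions has no negative interior minimum
    outside the sphere. At a negative minimum on the boundary, the nonlinear boundary condition
    and [q < n / (n - 2)] force [r ^ s u] to be no larger than at the reflected point, for some
    exponent [s > (n - 2) / 2]. If the difference is nonnegative for all radii up to [l], this
    inequality fails strictly for the radii close to [l], at infinity by the lower bound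
    [u >= eps r ^ (2 - n)], which comes from a radial barrier. So the radius can be increased
    without limit, that is, [U] is nondecreasing along every ray from every boundary centre.
    Letting the centre go to infinity shows that [u] does not depend on [x'], and an energy
    argument integrates [f'' = n (n - 2) f ^ p] on the half line. *)

(** No strong maximum principle for the difference is used. The zeroth-order term of the cylindrical
    Laplacian, with coefficient [(2 * b) ^+ 2 > 0], already makes a negative interior minimum
    contradictory. On the boundary, a negative minimum yields only an inequality between values of
    [cyl F beta], where [beta = (b + 2^-1) / q], and [b < beta] is the hypothesis [q < n / (n - 2)].
    A weak inequality for the weight [b] becomes strict for the heavier weight [beta], and this gap
    is the source of strictness: the open condition propagated in the radius is the strict ordering
    of [cyl F beta] between each boundary point inside the sphere and its inverse. The delicate
    places are the centre, whose inverse is at infinity, the sphere itself, where both points merge,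
    and the start [L = 0], where the two difficulties meet. Exponents are half the usual ones, since
    radii enter through their squares. *)

Definition pcoord {R : realType} {k : nat} (d : option 'I_k) (y : 'rV[R]_k * R) : R :=
  if d is Some i then y.1 0 i else y.2.

Definition mkpt {R : realType} {k : nat} (c : option 'I_k -> R) : 'rV[R]_k * R :=
  (\row_i c (Some i), c None).

Lemma cvg_sumr {R : realType} {T I : Type} {Fl : set_system T} {FF : Filter Fl}
    (r : seq I) (f : I -> T -> R) (l : I -> R) :
  (forall i, f i t @[t --> Fl] --> l i) ->
  \sum_(i <- r) f i t @[t --> Fl] --> \sum_(i <- r) l i.
Proof.
move=> h; elim: r => [|i r IH].
  rewrite big_nil (_ : (fun t => _) = fun=> 0); first exact: cvg_cst.
  by apply/funext => t; rewrite big_nil.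
rewrite big_cons (_ : (fun t => _) = fun t => f i t + \sum_(i <- r) f i t).
  exact: cvgD.
by apply/funext => t; rewrite big_cons.
Qed.

(** * Points and curves *)

Section Points.
Context {R : realType} {k : nat}.
Local Notation X := ('rV[R]_k * R)%type.
Local Notation D := (option 'I_k).

Lemma pcoord_mkpt (c : D -> R) d : pcoord d (mkpt c) = c d.
Proof. by case: d => [i|] //=; rewrite mxE. Qed.

Lemma ptP (y z : X) : (forall d, pcoord d y = pcoord d z) -> y = z.
Proof.
move=> h; case: y z h => [x t] [x' t'] h; congr (_, _); last exact: (h None).
by apply/rowP => i; exact: (h (Some i)).
Qed.

Lemma pcoordD d (y z : X) : pcoord d (y + z) = pcoord d y + pcoord d z.
Proof. by case: d => [i|] //=; rewrite mxE. Qed.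


Lemma pcoordZ d c (y : X) : pcoord d (c *: y) = c * pcoord d y.
Proof. by case: d => [i|] //=; rewrite mxE. Qed.

Lemma pcoord0 d : pcoord d (0 : X) = 0.
Proof. by case: d => [i|] //=; rewrite mxE. Qed.

(** Neighbourhoods become boxes indexed by [D], so that horizontal and vertical coordinates need no
    separate treatment. *)
Lemma nbhs_pt (y : X) (P : set X) :
  nbhs y P <-> exists2 e, 0 < e & forall z, (forall d, `|pcoord d y - pcoord d z| < e) -> P z.
Proof.
split.
  move=> /nbhs_ballP [e /= e0 he]; exists e => // z hz; apply: he; split => /=.
    split => // i j; rewrite [i]ord1; exact: (hz (Some j)).
  exact: (hz None).
move=> [e e0 he]; apply/nbhs_ballP; exists e => //= z [[_ h1] h2]; apply: he => -[i|].
  exact: (h1 0 i).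
exact: h2.
Qed.

Lemma cvg_pt {T : Type} {Fl : set_system T} {FF : Filter Fl} (f : T -> X) (y : X) :
  (forall d, pcoord d (f t) @[t --> Fl] --> pcoord d y) -> f t @[t --> Fl] --> y.
Proof.
move=> h A /nbhs_pt [e e0 he].
have : \forall t \near Fl, forall d : D, `|pcoord d y - pcoord d (f t)| < e.
  apply: filter_forall => d.
  by have /cvgrPdist_lt := h d; apply.
by move=> H; near=> t; apply: he; near: t.
Unshelve. all: by end_near. Qed.

Lemma pcoord_continuous d : continuous (pcoord d : X -> R).
Proof.
move=> y; apply/cvgrPdist_lt => e e0; apply/nbhs_pt; exists e => // z; exact.
Qed.

End Points.

Definition dirv {R : realType} {k : nat} (d : option 'I_k) : 'rV[R]_k * R :=
  mkpt (fun e => (e == d)%:R).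

(** Only partial derivatives, and only in the open half-space; derivatives along curves are
    recovered in [chain_rule] from the continuity of the partials. *)
Definition has_grad {R : realType} {k : nat} (f : 'rV[R]_k * R -> R)
    (g : option 'I_k -> 'rV[R]_k * R -> R) : Prop :=
  forall y, 0 < y.2 -> forall d, is_derive (0 : R) 1 (fun s => f (y + s *: dirv d)) (g d y).

Section Derivatives.
Context {R : realType}.

Lemma is_deriveP (f : R -> R) (a D : R) :
  is_derive a 1 f D <-> h^-1 * (f (h + a) - f a) @[h --> 0^'] --> D.
Proof.
have E : (fun h => h^-1 *: (f (h *: 1 + a) - f a)) = (fun h => h^-1 * (f (h + a) - f a)).
  by apply/funext => h; rewrite /GRing.scale /= mulr1.
split.
  by move=> [df dv]; rewrite -dv /derive -E; exact: df.
move=> h; split; first by apply/cvg_ex; exists D; rewrite E; exact: h.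
by rewrite /derive E; apply/cvg_lim.
Qed.

Lemma is_derive_eps (f : R -> R) (a D : R) :
  is_derive a 1 f D <->
  forall e, 0 < e -> \forall s \near a, `|f s - f a - D * (s - a)| <= e * `|s - a|.
Proof.
rewrite is_deriveP; split.
  move/cvgrPdist_le => H e e0; have /nbhs_ballP[d /= d0 hd] := H e e0.
  apply/nbhs_ballP; exists d => //= s sd.
  have [->|sa] := eqVneq s a; first by rewrite !subrr mulr0 subr0 normr0 mulr0.
  have h0 : s - a != 0 by rewrite subr_eq0.
  have sd' : ball 0 d (s - a) by move: sd; rewrite /ball /= sub0r normrN distrC.
  have := hd (s - a) sd' h0.
  rewrite subrK => H1.
  have -> : f s - f a - D * (s - a) = - ((D - (s - a)^-1 * (f s - f a)) * (s - a)).
    by field.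
  by rewrite normrN normrM; apply: ler_wpM2r.
move=> H; apply/cvgrPdist_le => e e0; have /nbhs_ballP[d /= d0 hd] := H e e0.
apply/nbhs_ballP; exists d => //= s; rewrite /ball /= sub0r normrN => sd s0.
have := hd (s + a); rewrite /ball /= distrC addrK => /(_ sd) H1.
rewrite -(ler_pM2r (_ : 0 < `|s|)) ?normr_gt0 // -normrM.
move: H1; congr (_ <= _); rewrite -normrN; congr (`| _ |); field.
exact: s0.
Qed.

Lemma is_derive_shift0 (f : R -> R) (a D : R) :
  is_derive (0 : R) 1 (fun s => f (a + s)) D <-> is_derive a 1 f D.
Proof.
rewrite !is_deriveP; suff -> : (fun h => h^-1 * (f (h + a) - f a)) =
  (fun h => h^-1 * (f (a + (h + 0)) - f (a + 0))) by [].
by apply/funext => h; rewrite !addr0 (addrC h).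
Qed.

Lemma is_derive_continuous {f : R -> R} {a D : R} :
  is_derive a 1 f D -> {for a, continuous f}.
Proof.
by move=> [/derivable1_diffP df _]; exact: differentiable_continuous.
Qed.

Lemma is_derive1_comp {f g : R -> R} {a Df Dg : R} :
  is_derive (g a) 1 f Df -> is_derive a 1 g Dg ->
  is_derive a 1 (fun s => f (g s)) (Df * Dg).
Proof.
move=> df dg.
have df1 : derivable f (g a) 1 by case: df.
have dg1 : derivable g a 1 by case: dg.
split.
  by apply/derivable1_diffP; apply: differentiable_comp; exact/derivable1_diffP.
have := derive1_comp dg1 df1; rewrite !derive1E => ->.
by rewrite !derive_val.
Qed.

End Derivatives.

(** * Chain rule along curves, from continuous partial derivatives *)

Section ChainRule.
Context {R : realType} {k : nat}.
Local Notation X := ('rV[R]_k * R)%type.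
Local Notation D := (option 'I_k).

Lemma pcoord_dirv (d e : D) : pcoord e (dirv d : X) = (e == d)%:R.
Proof. by rewrite pcoord_mkpt. Qed.

Variables (f : X -> R) (g : D -> X -> R).
Hypothesis fg : has_grad f g.

Lemma has_grad_line (y : X) d (s : R) : 0 < (y + s *: dirv d).2 ->
  is_derive s 1 (fun s => f (y + s *: dirv d)) (g d (y + s *: dirv d)).
Proof.
move=> h; apply/is_derive_shift0.
have := fg _ h d; congr is_derive; apply/funext => t.
by rewrite scalerDl addrA.
Qed.

(** The symmetric bound on [s] lets one statement cover both signs of the increment [c]. *)
Lemma has_grad_mvt (y : X) d (c : R) :
  (forall s : R, `|s| <= `|c| -> 0 < (y + s *: dirv d).2) ->
  exists2 s, `|s| <= `|c| & f (y + c *: dirv d) - f y = g d (y + s *: dirv d) * c.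
Proof.
move=> h.
have dl (s : R) : `|s| <= `|c| -> is_derive s 1 (fun s => f (y + s *: dirv d)) (g d (y + s *: dirv d)).
  by move=> /h; exact: has_grad_line.
have cl (a b : R) : (forall s : R, s \in `[a, b] -> `|s| <= `|c|) ->
    {within `[a, b], continuous (fun s => f (y + s *: dirv d))}.
  move=> hab; apply: continuous_in_subspaceT => s; rewrite inE => /hab /dl.
  exact: is_derive_continuous.
have y0 : f y = f (y + 0 *: dirv d) by rewrite scale0r addr0.
case: (leP 0 c) => c0.
  have hab (s : R) : s \in `[0, c] -> `|s| <= `|c|.
    by rewrite in_itv /= => /andP[s0 sc]; rewrite !ger0_norm.
  have [s /hab hs] := @MVT_segment _ _ (fun s => g d (y + s *: dirv d)) _ _ c0
    (fun s hs => dl s (hab s (subset_itv_oo_cc hs))) (cl _ _ hab).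
  by rewrite subr0 -y0 => E; exists s.
have hab (s : R) : s \in `[c, 0] -> `|s| <= `|c|.
  by rewrite in_itv /= => /andP[s0 sc]; rewrite !ler0_norm ?lerN2 // ltW.
have [s /hab hs] := @MVT_segment _ _ (fun s => g d (y + s *: dirv d)) _ _ (ltW c0)
    (fun s hs => dl s (hab s (subset_itv_oo_cc hs))) (cl _ _ hab).
by rewrite sub0r -y0 => E; exists s => //; lra.
Qed.

Variables (s0 : R) (c : D -> R -> R) (c' : D -> R).
Hypothesis dc : forall d, is_derive s0 1 (c d) (c' d).
Let y0 : X := mkpt (fun d => c d s0).
Hypothesis y0_pos : 0 < y0.2.
Hypothesis g_cont : forall d, {for y0, continuous (g d)}.

(** Coordinates in [l] have moved to time [s], the others are still at [s0]. Enlarging [l] one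
    coordinate at a time writes the increment of [f] as a telescoping sum along coordinate lines. *)
Let P (l : seq D) (s : R) : X := mkpt (fun d => if d \in l then c d s else c d s0).

Let near_P (eta : R) : 0 < eta ->
  \forall s \near s0, forall d, `|c d s - c d s0| < eta.
Proof.
move=> eta0.
have H (d : D) : \forall s \near s0, `|c d s - c d s0| < eta.
  have /is_derive_continuous /cvgrPdist_lt /(_ _ eta0) := dc d.
  by apply: filterS => s; rewrite distrC.
exact: (@filter_forall _ _ _ _ (nbhs_filter s0) H).
Qed.

(** The mean value theorem between [P l s] and [P (d :: l) s] evaluates [g d] at a point that tends
    to [y0], where continuity replaces it by [g d y0]. *)
Let step (l : seq D) (d : D) : d \notin l ->
  is_derive s0 1 (fun s => f (P (d :: l) s) - f (P l s)) (g d y0 * c' d).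
Proof.
move=> dl; apply/is_derive_eps => e e0.
(* [M] will bound the difference quotients of [c d] near [s0], and [N] bounds [g d y0]; the two
   errors, in [g d] and in [c d], each receive half of [e]. *)
set M := `|c' d| + 1; set N := `|g d y0| + 1.
have M0 : 0 < M by rewrite ltr_wpDl.
have N0 : 0 < N by rewrite ltr_wpDl.
have e1 : 0 < e / (2 * M) by rewrite divr_gt0 // mulr_gt0.
have e2 : 0 < Num.min 1 (e / (2 * N)).
  by rewrite lt_min ltr01 /= divr_gt0 // mulr_gt0.
have /nbhs_pt [eta eta0 Heta] : nbhs y0 [set z | `|g d z - g d y0| < e / (2 * M) /\ 0 < z.2].
  apply: filterI.
    have /cvgrPdist_lt /(_ _ e1) := g_cont d.
    by apply: filterS => z; rewrite distrC.
  have /cvgrPdist_lt /(_ _ y0_pos) := @pcoord_continuous _ _ None y0.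
  by apply: filterS => z; rewrite /pcoord ltr_distl => /andP[_]; rewrite ltrDr.
have /is_derive_eps /(_ _ e2) H2 := dc d.
near=> s.
have Hs : forall e, `|c e s - c e s0| < eta by near: s; exact: near_P.
have H2s : `|c d s - c d s0 - c' d * (s - s0)| <= Num.min 1 (e / (2 * N)) * `|s - s0|.
  by near: s.
have PE : P (d :: l) s = P l s + (c d s - c d s0) *: dirv d.
  apply: ptP => b; rewrite pcoordD pcoordZ !pcoord_mkpt in_cons.
  case: eqVneq => [->|bd] /=; last by rewrite mulr0 addr0.
  by rewrite (negbTE dl) mulr1 addrC subrK.
have E0 : f (P (d :: l) s0) - f (P l s0) = 0.
  suff -> : P (d :: l) s0 = P l s0 by rewrite subrr.
  by apply: ptP => b; rewrite !pcoord_mkpt; case: ifP; case: ifP.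
have near_y0 (t : R) : `|t| <= `|c d s - c d s0| -> forall b, `|pcoord b y0 - pcoord b (P l s + t *: dirv d)| < eta.
  move=> ht b; rewrite pcoordD pcoordZ !pcoord_mkpt.
  case: (eqVneq b d) => [->|bd].
    rewrite (negbTE dl) mulr1 opprD addNKr normrN.
    exact: le_lt_trans ht (Hs d).
  rewrite mulr0 addr0; case: ifP => _; last by rewrite subrr normr0.
  by rewrite distrC.
have [t ht Et] := @has_grad_mvt (P l s) d (c d s - c d s0) (fun t ht => (Heta _ (near_y0 t ht)).2).
rewrite PE E0 subr0 Et.
have [/= Hg _] := Heta _ (near_y0 t ht).
set G := g d (P l s + t *: dirv d) in Hg *; set G0 := g d y0 in Hg *.
set dlt := c d s - c d s0 in H2s *.
have -> : G * dlt - G0 * c' d * (s - s0) =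
   (G - G0) * dlt + G0 * (dlt - c' d * (s - s0)) by ring.
apply: le_trans (ler_normD _ _) _; rewrite !normrM.
have d1 : `|dlt| <= M * `|s - s0|.
  have -> : dlt = (dlt - c' d * (s - s0)) + c' d * (s - s0) by ring.
  apply: le_trans (ler_normD _ _) _; rewrite normrM /M mulrDl mul1r addrC lerD2l.
  by apply: (le_trans H2s); apply: ler_piMl => //; rewrite ge_min lexx.
have d2 : `|dlt - c' d * (s - s0)| <= e / (2 * N) * `|s - s0|.
  by apply: (le_trans H2s); apply: ler_wpM2r => //; rewrite ge_min lexx orbT.
have -> : e * `|s - s0| = e / (2 * M) * (M * `|s - s0|) + N * (e / (2 * N) * `|s - s0|).
  by field; rewrite !lt0r_neq0.
apply: lerD; first by apply: ler_pM => //; exact: ltW.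
by apply: ler_pM => //; rewrite /N lerDl.
Unshelve. all: by end_near. Qed.

Lemma chain_rule_mkpt :
  is_derive s0 1 (fun s => f (mkpt (fun d => c d s))) (\sum_d g d y0 * c' d).
Proof.
have H (l : seq D) : uniq l ->
    is_derive s0 1 (fun s => f (P l s)) (\sum_(d <- l) g d y0 * c' d).
  elim: l => [_|d l IH /= /andP[dl /IH dP]].
    by rewrite big_nil; exact: (is_derive_cst (f (P [::] s0))).
  rewrite big_cons.
  suff -> : (fun s => f (P (d :: l) s)) =
    (fun s => f (P (d :: l) s) - f (P l s)) + (fun s => f (P l s)).
    by apply: is_deriveD; exact: step.
  by apply/funext => s; rewrite !fctE subrK.
have := H (index_enum (option 'I_k)) (index_enum_uniq _).
congr is_derive; apply/funext => s; congr f; apply: ptP => d.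
by rewrite !pcoord_mkpt mem_index_enum.
Qed.

End ChainRule.

Lemma chain_rule {R : realType} {k : nat} {f : 'rV[R]_k * R -> R} {g} {s0 : R}
    (c : R -> 'rV[R]_k * R) (c' : option 'I_k -> R) :
  has_grad f g -> 0 < (c s0).2 -> (forall d, {for c s0, continuous (g d)}) ->
  (forall d, is_derive s0 1 (fun s => pcoord d (c s)) (c' d)) ->
  is_derive s0 1 (fun s => f (c s)) (\sum_d g d (c s0) * c' d).
Proof.
move=> fg c0 gc dc.
have E s : mkpt (fun d => pcoord d (c s)) = c s by apply: ptP => d; rewrite pcoord_mkpt.
have := @chain_rule_mkpt R k f g fg s0 (fun d s => pcoord d (c s)) c' dc.
rewrite E => /(_ c0 gc); congr is_derive; by apply/funext => s; rewrite E.
Qed.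

(** * Second derivatives along dilations and rotations *)

Section SecondDerivative.
Context {R : realType}.
Implicit Types (f g : R -> R) (a b c : R).

Lemma derC a c : is_derive a 1 (fun _ : R => c) 0.
Proof. exact: is_derive_cst. Qed.

Lemma der_id a : is_derive a 1 (fun s : R => s) 1.
Proof. exact: is_derive_id. Qed.

Lemma derD {f g a df dg} : is_derive a 1 f df -> is_derive a 1 g dg ->
  is_derive a 1 (fun s => f s + g s) (df + dg).
Proof. by move=> hf hg; exact: is_deriveD. Qed.

Lemma derB {f g a df dg} : is_derive a 1 f df -> is_derive a 1 g dg ->
  is_derive a 1 (fun s => f s - g s) (df - dg).
Proof. by move=> hf hg; exact: is_deriveB. Qed.

Lemma derM {f g a df dg} : is_derive a 1 f df -> is_derive a 1 g dg ->
  is_derive a 1 (fun s => f s * g s) (f a * dg + g a * df).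
Proof. by move=> hf hg; exact: is_deriveM. Qed.

Lemma derZ c {f a df} : is_derive a 1 f df -> is_derive a 1 (fun s => c * f s) (c * df).
Proof. by move=> hf; exact: is_deriveZ. Qed.

Lemma der_eq {f a df} dg : is_derive a 1 f df -> df = dg -> is_derive a 1 f dg.
Proof. by move=> h <-. Qed.

Lemma der_sum {I : Type} (r : seq I) (F : I -> R -> R) (dF : I -> R) a :
  (forall i, is_derive a 1 (F i) (dF i)) ->
  is_derive a 1 (fun s => \sum_(i <- r) F i s) (\sum_(i <- r) dF i).
Proof.
move=> h; elim: r => [|i r IH].
  rewrite big_nil (_ : (fun _ => _) = fun=> 0); first exact: derC.
  by apply/funext => s; rewrite big_nil.
rewrite big_cons (_ : (fun _ => _) = fun s => F i s + \sum_(i <- r) F i s); first exact: derD.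
by apply/funext => s; rewrite big_cons.
Qed.

Lemma der_expRM c a : is_derive a 1 (fun s => expR (c * s)) (c * expR (c * a)).
Proof.
have h : is_derive a 1 (fun s : R => c * s) c.
  by apply: der_eq (derZ c (der_id a)) _; rewrite mulr1.
by apply: der_eq (is_derive1_comp (g := fun s => c * s) (is_derive_expR (c * a)) h) _; rewrite mulrC.
Qed.

(** [b] and [c] are the first and second derivatives at [0]. The first derivative is asked for near
    [0] only, because a curve may leave the half-space farther away. *)
Definition has_d2 f b c : Prop := exists f1 : R -> R,
  [/\ \forall s \near (0 : R), is_derive (s : R) 1 f (f1 s), f1 0 = b & is_derive (0 : R) 1 f1 c].

(** If [c < 0], the sign of [f1 0] chooses a side: [f1] is negative just to the right of [0] when
    [f1 0 <= 0], and positive just to the left otherwise. Either way the mean value theorem puts [f]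
    below [f 0]. *)
Lemma d2_min {f b c} : has_d2 f b c -> (\forall s \near (0 : R), f 0 <= f s) -> 0 <= c.
Proof.
move=> [f1 [df _ df1]] fmin; rewrite leNgt; apply/negP => c0.
have e0 : 0 < - c / 2 by lra.
have /is_derive_eps /(_ _ e0) H := df1.
have : \forall s \near (0 : R), [/\ is_derive (s : R) 1 f (f1 s), f 0 <= f s
    & `|f1 s - f1 0 - c * (s - 0)| <= - c / 2 * `|s - 0|].
  by apply: filterS3 df fmin H => s ? ? ?; split.
move=> /nbhs_ballP[r /= r0 hr].
have near0 (s : R) : `|s| < r -> [/\ is_derive s 1 f (f1 s), f 0 <= f s
    & `|f1 s - f1 0 - c * s| <= - c / 2 * `|s|].
  by move=> sr; have := hr s; rewrite /ball /= sub0r normrN subr0; apply.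
case: (leP (f1 0) 0) => f10.
  have r2 : 0 < r / 2 by lra.
  have inr (s : R) : s \in `[0, r / 2] -> `|s| < r.
    by rewrite in_itv /= => /andP[? ?]; rewrite ger0_norm //; lra.
  have [|s hs E] := @MVT _ f f1 _ _ r2 (fun s hs => let: And3 d _ _ := near0 s (inr s (subset_itv_oo_cc hs)) in d).
    apply: continuous_in_subspaceT => s; rewrite inE => /inr /near0 [d _ _].
    exact: is_derive_continuous d.
  have [_ _ le1] := near0 s (inr s (subset_itv_oo_cc hs)).
  have le2 : f 0 <= f (r / 2).
    by have [] := near0 (r / 2) (inr _ _) => //; rewrite in_itv /=; apply/andP; split; lra.
  move: hs; rewrite in_itv /= => /andP[s0 _].
  move: le1; rewrite (gtr0_norm s0) ler_norml => /andP[_ le1].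
  have : c * s < 0 by rewrite nmulr_rlt0.
  have : f1 s < 0 -> f1 s * (r / 2 - 0) < 0 by move=> ?; rewrite subr0 nmulr_rlt0.
  by lra.
have r2 : - (r / 2) < 0 by lra.
have inr (s : R) : s \in `[- (r / 2), 0] -> `|s| < r.
  by rewrite in_itv /= => /andP[? ?]; rewrite ler0_norm //; lra.
have [|s hs E] := @MVT _ f f1 _ _ r2 (fun s hs => let: And3 d _ _ := near0 s (inr s (subset_itv_oo_cc hs)) in d).
  apply: continuous_in_subspaceT => s; rewrite inE => /inr /near0 [d _ _].
  exact: is_derive_continuous d.
have [_ _ le1] := near0 s (inr s (subset_itv_oo_cc hs)).
have le2 : f 0 <= f (- (r / 2)).
  by have [] := near0 (- (r / 2)) (inr _ _) => //; rewrite in_itv /=; apply/andP; split; lra.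
move: hs; rewrite in_itv /= => /andP[_ s0].
move: le1; rewrite (ltr0_norm s0) ler_norml => /andP[le1 _].
have : 0 < c * s by rewrite nmulr_rgt0.
have : 0 < f1 s -> 0 < f1 s * (0 - - (r / 2)) by move=> ?; rewrite mulr_gt0 //; lra.
by lra.
Qed.

Lemma d2_eq {f b c} b' c' : has_d2 f b c -> b = b' -> c = c' -> has_d2 f b' c'.
Proof. by move=> ? <- <-. Qed.

Lemma d2C c : has_d2 (fun _ => c) 0 0.
Proof.
exists (fun=> 0); split => //; last exact: derC.
by near=> s; exact: derC.
Unshelve. all: by end_near. Qed.

Lemma d2B {f g bf bg cf cg} : has_d2 f bf cf -> has_d2 g bg cg ->
  has_d2 (fun s => f s - g s) (bf - bg) (cf - cg).
Proof.
move=> [f1 [df <- df1]] [g1 [dg <- dg1]]; exists (fun s => f1 s - g1 s); split => //.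
  by near=> s; apply: derB; near: s.
exact: derB.
Unshelve. all: by end_near. Qed.

Lemma d2D {f g bf bg cf cg} : has_d2 f bf cf -> has_d2 g bg cg ->
  has_d2 (fun s => f s + g s) (bf + bg) (cf + cg).
Proof.
move=> [f1 [df <- df1]] [g1 [dg <- dg1]]; exists (fun s => f1 s + g1 s); split => //.
  by near=> s; apply: derD; near: s.
exact: derD.
Unshelve. all: by end_near. Qed.

Lemma d2M {f g bf bg cf cg} : has_d2 f bf cf -> has_d2 g bg cg ->
  has_d2 (fun s => f s * g s) (f 0 * bg + g 0 * bf) (f 0 * cg + 2 * bf * bg + g 0 * cf).
Proof.
move=> [f1 [df <- df1]] [g1 [dg <- dg1]].
exists (fun s => f s * g1 s + g s * f1 s); split => //.
  by near=> s; apply: derM; near: s.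
have df0 : is_derive (0 : R) 1 f (f1 0) by exact: (nbhs_singleton (p := 0) df).
have dg0 : is_derive (0 : R) 1 g (g1 0) by exact: (nbhs_singleton (p := 0) dg).
by apply: der_eq (derD (derM df0 dg1) (derM dg0 df1)) _; ring.
Unshelve. all: by end_near. Qed.

Lemma d2Z k {f b c} : has_d2 f b c -> has_d2 (fun s => k * f s) (k * b) (k * c).
Proof. by move=> h; apply: d2_eq (d2M (d2C k) h) _ _; ring. Qed.

(** Needed for the inversion, which reverses the dilation flow. *)
Lemma d2_opp {f b c} : has_d2 f b c -> has_d2 (fun s => f (- s)) (- b) c.
Proof.
move=> [f1 [df <- df1]]; exists (fun s => - f1 (- s)).
have dN (s : R) : is_derive s 1 (fun s : R => - s) (- 1) by exact: is_deriveNid.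
split; last 1 first.
- have d0 : is_derive (- (0 : R)) 1 f1 c by rewrite oppr0.
  rewrite (_ : (fun s => - f1 (- s)) = fun s => - 1 * f1 (- s)).
    by apply: der_eq (derZ (- 1) (is_derive1_comp (g := -%R) d0 (dN 0))) _; ring.
  by apply/funext => s; rewrite mulN1r.
- have /nbhs_ballP[r /= r0 hr] := df; apply/nbhs_ballP; exists r => //= s.
  rewrite /ball /= sub0r normrN => sr; have := hr (- s).
  rewrite /ball /= sub0r !normrN => /(_ sr) d.
  by apply: der_eq (is_derive1_comp (g := -%R) d (dN s)) _; ring.
- by rewrite oppr0.
Qed.

Lemma d2_expRM c : has_d2 (fun s => expR (c * s)) c (c ^+ 2).
Proof.
exists (fun s => c * expR (c * s)); split.
- by near=> s; exact: der_expRM.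
- by rewrite mulr0 expR0 mulr1.
- by apply: der_eq (derZ c (der_expRM c 0)) _; rewrite mulr0 expR0; ring.
Unshelve. all: by end_near. Qed.

End SecondDerivative.

Definition sqn {R : realType} {k : nat} (y : 'rV[R]_k * R) : R :=
  \sum_(d : option 'I_k) pcoord d y ^+ 2.

(* The functions live on the whole space, [F] and [G] being extended continuously to [t < 0], so
   that continuity up to the boundary is plain continuity. *)
Record halfspace_solution {R : realType} {k : nat} (K p q c : R)
    (F : 'rV[R]_k * R -> R) (G : option 'I_k -> 'rV[R]_k * R -> R)
    (H : option 'I_k -> option 'I_k -> 'rV[R]_k * R -> R) : Prop := HalfspaceSolution {
  sol_cont : continuous F;
  sol_grad_cont : forall d, continuous (G d);
  sol_hess_cont : forall d e y, 0 < y.2 -> {for y, continuous (H d e)};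
  sol_grad : has_grad F G;
  sol_hess : forall d, has_grad (G d) (H d);
  sol_pde : forall y, 0 < y.2 -> \sum_d H d d y = K * F y `^ p;
  sol_bd : forall y, y.2 = 0 -> G None y = - c * F y `^ q;
  sol_pos : forall y, 0 <= y.2 -> 0 < F y }.

Arguments sol_cont {R k K p q c F G H} _.
Arguments sol_grad_cont {R k K p q c F G H} _.
Arguments sol_hess_cont {R k K p q c F G H} _.
Arguments sol_grad {R k K p q c F G H} _.
Arguments sol_hess {R k K p q c F G H} _.
Arguments sol_pde {R k K p q c F G H} _.
Arguments sol_bd {R k K p q c F G H} _.
Arguments sol_pos {R k K p q c F G H} _.

Definition rotation {R : realType} {k : nat} (d e : option 'I_k) (tau : R)
    (y : 'rV[R]_k * R) : 'rV[R]_k * R :=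
  mkpt (fun j => if j == d then cos tau * pcoord d y - sin tau * pcoord e y
                 else if j == e then sin tau * pcoord d y + cos tau * pcoord e y
                 else pcoord j y).

Section Curves.
Context {R : realType} {k : nat}.
Local Notation X := ('rV[R]_k * R)%type.
Local Notation D := (option 'I_k).
Implicit Types (y z : X) (d e : D).

Lemma sqn_ge0 y : 0 <= sqn y.
Proof. by apply: sumr_ge0 => d _; exact: sqr_ge0. Qed.

Lemma sqnZ c y : sqn (c *: y) = c ^+ 2 * sqn y.
Proof. by rewrite /sqn big_distrr /=; apply: eq_bigr => d _; rewrite pcoordZ exprMn. Qed.

Lemma le_sqr_sqn d y : pcoord d y ^+ 2 <= sqn y.
Proof. by rewrite /sqn (bigD1 d) //= lerDl sumr_ge0 // => e _; exact: sqr_ge0. Qed.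

Lemma sqn_eq0 y : (sqn y == 0) = (y == 0).
Proof.
apply/idP/eqP => [h|->]; last first.
  by rewrite /sqn big1 // => d _; rewrite pcoord0 expr0n.
apply: ptP => d; rewrite pcoord0; apply/eqP; rewrite -sqrf_eq0 eq_le sqr_ge0 andbT.
by rewrite -(eqP h) le_sqr_sqn.
Qed.

Lemma sqn_gt0 y : (0 < sqn y) = (y != 0).
Proof. by rewrite lt_def sqn_eq0 sqn_ge0 andbT. Qed.

Lemma pos_sqn_gt0 y : 0 < y.2 -> 0 < sqn y.
Proof.
move=> y0; rewrite sqn_gt0; apply/eqP => yE.
by move: y0; rewrite yE ltxx.
Qed.

Lemma sqn_continuous : continuous (sqn : X -> R).
Proof.
move=> y; apply: cvg_sumr => d.
rewrite (_ : (fun z => _) = (fun z => pcoord d z * pcoord d z)); last first.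
  by apply/funext => z; rewrite expr2.
by rewrite expr2; apply: cvgM; exact: pcoord_continuous.
Qed.

Lemma sqn_rotation d e tau y : e != d -> sqn (rotation d e tau y) = sqn y.
Proof.
move=> ed; rewrite /sqn (bigD1 d) // (bigD1 e) //= [RHS](bigD1 d) // [in RHS](bigD1 e) //=.
rewrite !addrA; congr (_ + _).
  rewrite !pcoord_mkpt !eqxx (negbTE ed).
  have E : cos tau ^+ 2 + sin tau ^+ 2 = 1 := cos2Dsin2 tau.
  rewrite -[RHS]mul1r -{}E; ring.
by apply: eq_bigr => j /andP[jd je]; rewrite pcoord_mkpt (negbTE jd) (negbTE je).
Qed.

Lemma rotationZ d e tau c y : rotation d e tau (c *: y) = c *: rotation d e tau y.
Proof.
apply: ptP => j; rewrite pcoordZ !pcoord_mkpt !pcoordZ; case: ifP => _; first by ring.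
by case: ifP => _ //; ring.
Qed.

Lemma rotation0 d e y : e != d -> rotation d e 0 y = y.
Proof.
move=> ed; apply: ptP => j; rewrite pcoord_mkpt cos0 sin0 !mul1r !mul0r subr0 add0r.
by case: eqP => [->//|_]; case: eqP => [->|].
Qed.

Lemma der_rotation d e (tau : R) y (j : D) : e != d ->
  is_derive tau 1 (fun s => pcoord j (rotation d e s y))
    ((j == e)%:R * (cos tau * pcoord d y - sin tau * pcoord e y) -
     (j == d)%:R * (sin tau * pcoord d y + cos tau * pcoord e y)).
Proof.
move=> ed; rewrite (_ : (fun s => _) = (fun s =>
   if j == d then cos s * pcoord d y - sin s * pcoord e y
   else if j == e then sin s * pcoord d y + cos s * pcoord e y
   else pcoord j y)); last by apply/funext => s; rewrite pcoord_mkpt.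
have dc := is_derive_cos tau; have ds := is_derive_sin tau.
case: (eqVneq j d) => [jd|jd].
  rewrite -jd eq_sym in ed; rewrite (negbTE ed).
  by apply: der_eq (derB (derM dc (derC tau _)) (derM ds (derC tau _))) _; rewrite /= ?mulr1n ?mulr0n; ring.
case: (eqVneq j e) => [je|je].
  by apply: der_eq (derD (derM ds (derC tau _)) (derM dc (derC tau _))) _; rewrite /= ?mulr1n ?mulr0n; ring.
by apply: der_eq (derC tau _) _; rewrite /= ?mulr1n ?mulr0n; ring.
Qed.

Lemma sum_deltaM (w : D -> R) d : \sum_j w j * (j == d)%:R = w d.
Proof.
rewrite (bigD1 d) //= eqxx mulr1 big1 ?addr0 // => j /negbTE ->.
by rewrite mulr0.
Qed.

Lemma d2_curve (F : X -> R) (G : D -> X -> R) (H : D -> D -> X -> R)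
    (c : R -> X) (c1 : D -> R -> R) (c2 : D -> R) :
  has_grad F G -> (forall d, has_grad (G d) (H d)) ->
  (forall d, continuous (G d)) ->
  (forall d e y, 0 < y.2 -> {for y, continuous (H d e)}) ->
  0 < (c 0).2 ->
  (forall d (s : R), is_derive s 1 (fun s => pcoord d (c s)) (c1 d s)) ->
  (forall d, is_derive (0 : R) 1 (c1 d) (c2 d)) ->
  has_d2 (fun s => F (c s)) (\sum_d G d (c 0) * c1 d 0)
    (\sum_d ((\sum_e H d e (c 0) * c1 e 0) * c1 d 0 + G d (c 0) * c2 d)).
Proof.
move=> FG GH Gc Hc c0 dc dc1; exists (fun s => \sum_d G d (c s) * c1 d s); split => //.
  have : \forall s \near (0 : R), 0 < (c s).2.
    have /is_derive_continuous /cvgrPdist_lt /(_ _ c0) := dc None 0.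
    by apply: filterS => s; rewrite /pcoord ltr_distl => /andP[_]; rewrite ltrDr.
  apply: filterS => s cs; apply: chain_rule => // d; exact: Gc.
have dG d : is_derive (0 : R) 1 (fun s => G d (c s)) (\sum_e H d e (c 0) * c1 e 0).
  by apply: chain_rule => // e; exact: Hc.
apply: der_eq (der_sum _ (fun d s => G d (c s) * c1 d s) _ 0 (fun d => derM (dG d) (dc1 d))) _.
by apply: eq_bigr => d _; ring.
Qed.

End Curves.

Section CylindricalLaplacian.
Context {R : realType} {k : nat}.
Local Notation X := ('rV[R]_k * R)%type.
Local Notation D := (option 'I_k).
Variables (F : X -> R) (G : D -> X -> R) (H : D -> D -> X -> R).
Hypotheses (FG : has_grad F G) (GH : forall d, has_grad (G d) (H d))
  (Gc : forall d, continuous (G d))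
  (Hc : forall d e y, 0 < y.2 -> {for y, continuous (H d e)}).
Variable b : R.
Implicit Types (y : X) (d e : D).

Lemma powR_sqn_expRZ (s : R) y :
  sqn (expR s *: y) `^ b = sqn y `^ b * expR ((2 * b) * s).
Proof.
rewrite sqnZ powRM ?sqr_ge0 ?sqn_ge0 // mulrC; congr (_ * _).
by rewrite expr2 -expRD -expRM; congr expR; ring.
Qed.

Lemma d2_dilation y : 0 < y.2 ->
  exists b1, has_d2 (fun s => sqn (expR s *: y) `^ b * F (expR s *: y)) b1
   (sqn y `^ b * ((2 * b) ^+ 2 * F y + (4 * b + 1) * (\sum_d G d y * pcoord d y) +
      \sum_d (\sum_e H d e y * pcoord e y) * pcoord d y)).
Proof.
move=> y0.
have E1 : expR 0 *: y = y by rewrite expR0 scale1r.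
have dy d (s : R) : is_derive s 1 (fun s => pcoord d (expR s *: y)) (expR s * pcoord d y).
  rewrite (_ : (fun s => _) = fun s => expR s * pcoord d y); last first.
    by apply/funext => t; rewrite pcoordZ.
  by apply: der_eq (derM (is_derive_expR s) (derC s _)) _; ring.
have dy2 d : is_derive (0 : R) 1 (fun s => expR s * pcoord d y) (pcoord d y).
  apply: der_eq (derM (is_derive_expR 0) (derC 0 _)) _.
  by rewrite expR0; ring.
have y1 : 0 < (expR 0 *: y).2 by rewrite E1.
have := d2_curve _ _ _ _ _ _ FG GH Gc Hc y1 dy dy2.
rewrite E1 => h; eexists.
rewrite (_ : (fun s => _) = fun s => sqn y `^ b * (expR ((2 * b) * s) * F (expR s *: y))).
  apply: d2_eq (d2Z (sqn y `^ b) (d2M (d2_expRM (2 * b)) h)) erefl _.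
  rewrite mulr0 expR0 /= scale1r big_split /=.
  have -> : \sum_d G d y * (1 * pcoord d y) = \sum_d G d y * pcoord d y.
    by apply: eq_bigr => d _; rewrite mul1r.
  have -> : \sum_d (\sum_e H d e y * (1 * pcoord e y)) * (1 * pcoord d y) =
      \sum_d (\sum_e H d e y * pcoord e y) * pcoord d y.
    apply: eq_bigr => d _; rewrite mul1r; congr (_ * _).
    by apply: eq_bigr => e _; rewrite mul1r.
  by rewrite mul1r; ring.
by apply/funext => s; rewrite powR_sqn_expRZ mulrA.
Qed.

(** [H d e] and [H e d] are kept apart, no symmetry of [H] being assumed; summed over ordered pairs,
    both give the same radial quadratic form. *)
Definition rotation_d2 y d e : R :=
  H d d y * pcoord e y ^+ 2 - H d e y * pcoord e y * pcoord d y
  - H e d y * pcoord d y * pcoord e y + H e e y * pcoord d y ^+ 2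
  - G d y * pcoord d y - G e y * pcoord e y.

Lemma d2_rotation y d e : e != d -> 0 < y.2 ->
  exists b1, has_d2 (fun s => sqn (rotation d e s y) `^ b * F (rotation d e s y)) b1
    (sqn y `^ b * rotation_d2 y d e).
Proof.
move=> ed y0.
have y1 : 0 < (rotation d e 0 y).2 by rewrite rotation0.
have dr2 j : is_derive (0 : R) 1 (fun s : R =>
     (j == e)%:R * (cos s * pcoord d y - sin s * pcoord e y) -
     (j == d)%:R * (sin s * pcoord d y + cos s * pcoord e y))
   (- (j == e)%:R * pcoord e y - (j == d)%:R * pcoord d y).
  have dc := is_derive_cos (0 : R); have ds := is_derive_sin (0 : R).
  apply: der_eq (derB
    (derZ (j == e)%:R (derB (derM dc (derC 0 (pcoord d y))) (derM ds (derC 0 (pcoord e y)))))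
    (derZ (j == d)%:R (derD (derM ds (derC 0 (pcoord d y))) (derM dc (derC 0 (pcoord e y)))))) _.
  by rewrite cos0 sin0; ring.
have := d2_curve _ _ _ _ _ _ FG GH Gc Hc y1 (fun j s => der_rotation d e s y j ed) dr2.
rewrite rotation0 // cos0 sin0 => h; eexists.
rewrite (_ : (fun s => _) = fun s => sqn y `^ b * F (rotation d e s y)).
  apply: d2_eq (d2Z _ h) erefl _; congr (_ * _).
  have S (w : D -> R) : \sum_j w j * ((j == e)%:R * (1 * pcoord d y - 0 * pcoord e y) -
     (j == d)%:R * (0 * pcoord d y + 1 * pcoord e y)) = w e * pcoord d y - w d * pcoord e y.
    rewrite -(sum_deltaM w e) -(sum_deltaM w d) !mulr_suml -sumrB.
    by apply: eq_bigr => j _; ring.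
  rewrite big_split /= S !S.
  have -> : \sum_j G j y * (- (j == e)%:R * pcoord e y - (j == d)%:R * pcoord d y) =
      - G e y * pcoord e y - G d y * pcoord d y.
    rewrite -(sum_deltaM (fun j => G j y) e) -(sum_deltaM (fun j => G j y) d).
    rewrite mulNr !mulr_suml -sumrN -sumrB.
    by apply: eq_bigr => j _; ring.
  by rewrite /rotation_d2; ring.
by apply/funext => s; rewrite sqn_rotation.
Qed.

(* The dimension enters only here: [k = 4 b + 1] makes the first-order terms cancel. *)
Lemma dilation_rotation_sum y : k%:R = 4 * b + 1 ->
  ((2 * b) ^+ 2 * F y + (4 * b + 1) * (\sum_d G d y * pcoord d y) +
      \sum_d (\sum_e H d e y * pcoord e y) * pcoord d y) +
  2^-1 * (\sum_d \sum_(e | e != d) rotation_d2 y d e) =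
  sqn y * (\sum_d H d d y) + (2 * b) ^+ 2 * F y.
Proof.
move=> kb.
set S := \sum_d G d y * pcoord d y.
set HH := \sum_d (\sum_e H d e y * pcoord e y) * pcoord d y.
set T := \sum_d H d d y.
have cD : #|{: D}|%:R = 4 * b + 2 :> R.
  by rewrite card_option card_ord -addn1 natrD kb; ring.
have full : \sum_d \sum_e rotation_d2 y d e =
    2 * (sqn y * T) - 2 * HH - 2 * (4 * b + 2) * S.
  have s1 : \sum_d \sum_e H d d y * pcoord e y ^+ 2 = sqn y * T.
    rewrite mulrC mulr_suml; apply: eq_bigr => d _.
    by rewrite /sqn mulr_sumr.
  have s2 : \sum_d \sum_e H d e y * pcoord e y * pcoord d y = HH.
    by apply: eq_bigr => d _; rewrite mulr_suml.
  have s3 : \sum_d \sum_e H e d y * pcoord d y * pcoord e y = HH.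
    by rewrite exchange_big.
  have s4 : \sum_d \sum_e H e e y * pcoord d y ^+ 2 = sqn y * T.
    by rewrite exchange_big.
  have s5 : \sum_d \sum_(e : D) G d y * pcoord d y = (4 * b + 2) * S.
    under eq_bigr do rewrite sumr_const -mulr_natl cD.
    by rewrite -mulr_sumr.
  have s6 : \sum_(d : D) \sum_e G e y * pcoord e y = (4 * b + 2) * S.
    by rewrite exchange_big.
  transitivity (sqn y * T - HH - HH + sqn y * T - (4 * b + 2) * S - (4 * b + 2) * S); last by ring.
  rewrite -{1}s1 -{1}s2 -{1}s3 -{1}s4 -{1}s5 -s6 -!sumrB -big_split /= -!sumrB.
  apply: eq_bigr => d _; rewrite -!sumrB -big_split /= -!sumrB.
  by apply: eq_bigr => e _; rewrite /rotation_d2; ring.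
(* On the diagonal the Hessian terms of [rotation_d2] cancel and leave
   [- 2 * (G d y * pcoord d y)]. *)
have diag : \sum_d \sum_(e | e != d) rotation_d2 y d e =
    \sum_d \sum_e rotation_d2 y d e + 2 * S.
  rewrite mulr_sumr -big_split /=; apply: eq_bigr => d _.
  rewrite [in RHS](bigD1 d) //= /rotation_d2 addrAC -[LHS]add0r; congr (_ + _); ring.
by rewrite diag full; field.
Qed.

End CylindricalLaplacian.

(* [L] is the square of the radius; the junk value at [y = 0] is [0]. *)
Definition inversion {R : realType} {k : nat} (L : R) (y : 'rV[R]_k * R) : 'rV[R]_k * R :=
  (L / sqn y) *: y.

(** * Comparison with the inverted function *)

Section Minima.
Context {R : realType} {k : nat}.
Local Notation X := ('rV[R]_k * R)%type.
Local Notation D := (option 'I_k).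
Implicit Types (y z : X) (d e : D).

Lemma pcoord_le_sqn d y (M : R) : sqn y <= M -> `|pcoord d y| <= M + 1.
Proof.
move=> yM; have := le_sqr_sqn d y; have := sqn_ge0 y => s0 ds.
rewrite -(@ler_pXn2r _ 2) ?nnegrE //; last by lra.
rewrite real_normK ?num_real //; nra.
Qed.

Lemma compact_sqn_le (M : R) : compact [set y : X | sqn y <= M].
Proof.
have cx : compact [set x : 'rV[R]_k | forall i, `[- (M + 1), M + 1]%classic (x ord0 i)].
  by apply: (@rV_compact _ _ (fun=> `[- (M + 1), M + 1]%classic)) => _; exact: segment_compact.
have ct : compact `[- (M + 1), M + 1]%classic by exact: segment_compact.
apply: subclosed_compact (compact_setX cx ct) _.
  apply: (@closed_comp _ _ sqn [set x : R | x <= M]); last exact: closed_le.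
  by move=> y _; exact: sqn_continuous.
move=> y /= yM; split => /= [i|]; rewrite in_itv /= -ler_norml.
  exact: (pcoord_le_sqn (Some i) y).
exact: (pcoord_le_sqn None y).
Qed.

Lemma closed_half_annulus (L : R) : closed [set y : X | L <= sqn y /\ 0 <= y.2].
Proof.
apply: closedI.
  apply: (@closed_comp _ _ sqn [set x : R | L <= x]); last exact: closed_ge.
  by move=> y _; exact: sqn_continuous.
apply: (@closed_comp _ _ (pcoord None) [set x : R | 0 <= x]); last exact: closed_ge.
by move=> y _; exact: pcoord_continuous.
Qed.

(** The region is unbounded. Beyond [M] the values are at least [v y0], so it is enough to minimise
    over a ball that contains [y0] and has squared radius at least [M]. *)
Lemma half_annulus_min (v : X -> R) (L M : R) (y0 : X) :
  (forall y, L <= sqn y -> {for y, continuous v}) ->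
  L <= sqn y0 -> 0 <= y0.2 ->
  (forall y, L <= sqn y -> 0 <= y.2 -> M < sqn y -> v y0 <= v y) ->
  exists y, [/\ L <= sqn y, 0 <= y.2, v y <= v y0 &
    forall z, L <= sqn z -> 0 <= z.2 -> v y <= v z].
Proof.
move=> vc Ly0 y00 vM; set M1 := Num.max M (sqn y0).
pose A : set X := [set y | sqn y <= M1] `&` [set y | L <= sqn y /\ 0 <= y.2].
have cA : compact A by apply: compact_closedI; [exact: compact_sqn_le | exact: closed_half_annulus].
have Ay0 : A y0 by split => //=; rewrite /M1 le_max lexx orbT.
have [|y] := @compact_EVT_min _ _ v A (ex_intro _ y0 Ay0) cA.
  by apply: continuous_in_subspaceT => y; rewrite inE => -[_ [Ly _]]; exact: vc.
rewrite inE => -[_ [Ly y2]] ymin; exists y; split => //.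
  by apply: ymin; rewrite inE.
move=> z Lz z2; case: (leP (sqn z) M1) => zM; first by apply: ymin; rewrite inE.
apply: le_trans (ymin _ _) (vM _ Lz z2 _); first by rewrite inE.
by apply: le_lt_trans zM; rewrite /M1 le_max lexx.
Qed.

Lemma curve_cvg (c : R -> X) (s : R) (c1 : D -> R) :
  (forall d, is_derive s 1 (fun s => pcoord d (c s)) (c1 d)) -> c t @[t --> s] --> c s.
Proof. by move=> dc; apply: cvg_pt => d; exact: is_derive_continuous (dc d). Qed.

Lemma der_dilation (y : X) d (s : R) :
  is_derive s 1 (fun s => pcoord d (expR s *: y)) (expR s * pcoord d y).
Proof.
rewrite (_ : (fun s => _) = fun s => expR s * pcoord d y); last first.
  by apply/funext => t; rewrite pcoordZ.
by apply: der_eq (derM (is_derive_expR s) (derC s _)) _; ring.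
Qed.

Lemma sqn_inversion (L : R) y : 0 < sqn y -> sqn (inversion L y) = L ^+ 2 / sqn y.
Proof. by move=> y0; rewrite sqnZ; field; rewrite gt_eqF. Qed.

Lemma inversion_dilation (L s : R) y : inversion L (expR s *: y) = expR (- s) *: inversion L y.
Proof.
rewrite /inversion sqnZ !scalerA; congr (_ *: _); rewrite expRN.
have e0 := lt0r_neq0 (expR_gt0 s).
case: (eqVneq (sqn y) 0) => [->|y0]; first by rewrite mulr0 invr0 !mulr0 mul0r.
by field; rewrite e0 y0.
Qed.

Lemma inversion_rotation (L s : R) y d e : e != d ->
  inversion L (rotation d e s y) = rotation d e s (inversion L y).
Proof. by move=> ed; rewrite /inversion sqn_rotation // rotationZ. Qed.

Lemma inversion_continuous (L : R) y : 0 < sqn y -> {for y, continuous (inversion L)}.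
Proof.
move=> y0; apply: cvg_pt => d; rewrite pcoordZ.
rewrite (_ : (fun z => _) = (fun z => L / sqn z * pcoord d z)); last first.
  by apply/funext => z; rewrite pcoordZ.
apply: cvgM; last exact: pcoord_continuous.
apply: cvgM; first exact: cvg_cst.
by apply: cvgV; [rewrite gt_eqF | exact: sqn_continuous].
Qed.

End Minima.

Section Comparison.
Context {R : realType} {k : nat}.
Local Notation X := ('rV[R]_k * R)%type.
Local Notation D := (option 'I_k).
Implicit Types (y z : X) (d e : D).
Variables (F : X -> R) (G : D -> X -> R) (H : D -> D -> X -> R).
Variables (K p q c b : R).
Hypothesis sol : halfspace_solution K p q c F G H.
Hypothesis kb : k%:R = 4 * b + 1.

(* With [b = (n - 2) / 4], as [sqn] is the square of the norm. *)
Definition cyl (y : X) : R := sqn y `^ b * F y.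

Let FG := sol_grad sol.
Let GH := sol_hess sol.
Let Gc := sol_grad_cont sol.
Let Hc := sol_hess_cont sol.

(** This is the weight [sqn y ^ b] times [|y| ^ 2] Laplacian of [F] plus [((n - 2) / 2) ^ 2 F], with
    the Laplacian already replaced by means of the equation. *)
Definition cyl_laplacian (y : X) : R :=
  sqn y `^ b * (sqn y * (K * F y `^ p) + (2 * b) ^+ 2 * F y).

(** The factor [2^-1] appears because ordered pairs count every coordinate plane twice. The first
    derivatives stay hidden, since only second derivatives are compared at a minimum. *)
Lemma cyl_decomposition y : 0 < y.2 -> exists A (Bm : D -> D -> R),
  [/\ exists b1, has_d2 (fun s => cyl (expR s *: y)) b1 A,
    forall d e, e != d -> exists b1, has_d2 (fun s => cyl (rotation d e s y)) b1 (Bm d e) &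
    A + 2^-1 * (\sum_d \sum_(e | e != d) Bm d e) = cyl_laplacian y].
Proof.
move=> y0.
exists (sqn y `^ b * ((2 * b) ^+ 2 * F y + (4 * b + 1) * (\sum_d G d y * pcoord d y) +
      \sum_d (\sum_e H d e y * pcoord e y) * pcoord d y)).
exists (fun d e => sqn y `^ b * rotation_d2 G H y d e); split.
- exact: d2_dilation.
- by move=> d e ed; exact: d2_rotation.
- rewrite /cyl_laplacian -(sol_pde sol) // -(dilation_rotation_sum F G H b y kb).
  rewrite [RHS]mulrDr; congr (_ + _); rewrite mulrCA; congr (_ * _).
  by rewrite mulr_sumr; apply: eq_bigr => d _; rewrite mulr_sumr.
Qed.

(** The minimum is tested curve by curve, so the comparison function [E] needs second derivatives
    along these curves only. This serves both for the inverted function and for the radial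
    barrier. *)
Lemma interior_min_laplacian (E : X -> R) (aE b1 : R) (BE : D -> D -> R) y :
  0 < y.2 -> (\forall z \near y, cyl y - E y <= cyl z - E z) ->
  has_d2 (fun s => E (expR s *: y)) b1 aE ->
  (forall d e, e != d -> exists b2, has_d2 (fun s => E (rotation d e s y)) b2 (BE d e)) ->
  aE + 2^-1 * (\sum_d \sum_(e | e != d) BE d e) <= cyl_laplacian y.
Proof.
move=> y0 ymin dE rE; have [A [Bm [[b3 dU] rU <-]]] := cyl_decomposition y y0.
have le1 : aE <= A.
  rewrite -subr_ge0; apply: d2_min (d2B dU dE) _.
  rewrite expR0 scale1r.
  have := curve_cvg _ _ _ (fun d => der_dilation y d 0).
  by rewrite expR0 scale1r => /(_ _ ymin).
have le2 d e : e != d -> BE d e <= Bm d e.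
  move=> ed; have [b2 {}rE] := rE d e ed; have [b4 {}rU] := rU d e ed.
  rewrite -subr_ge0; apply: d2_min (d2B rU rE) _.
  rewrite rotation0 //.
  have := curve_cvg _ _ _ (fun j => der_rotation d e 0 y j ed).
  by rewrite rotation0 // => /(_ _ ymin).
apply: lerD => //; apply: ler_wpM2l; first by rewrite invr_ge0.
by apply: ler_sum => d _; apply: ler_sum => e ed; exact: le2.
Qed.

Lemma near_half_annulus (L : R) y : L < sqn y -> 0 < y.2 ->
  \forall z \near y, L <= sqn z /\ 0 <= z.2.
Proof.
move=> Ly y0; near=> z; split; apply: ltW; near: z.
  exact: (cvgr_gt _ (@sqn_continuous _ _ y)).
exact: (cvgr_gt _ (@pcoord_continuous _ _ None y)).
Unshelve. all: by end_near. Qed.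

Definition inversion_gap (L : R) y : R := cyl y - cyl (inversion L y).


(** Expressed through [cyl], the nonlinear term carries a power of the radius whose exponent is
    nonpositive by the bound on [p], and zero for the conformal exponent [(n + 2) / (n - 2)]. *)
Lemma cyl_laplacianE y : 0 < y.2 -> cyl_laplacian y =
  K * (sqn y `^ (b + 1 - b * p) * cyl y `^ p) + (2 * b) ^+ 2 * cyl y.
Proof.
move=> y0; have sy := pos_sqn_gt0 y y0.
rewrite /cyl_laplacian mulrDr /cyl [sqn y `^ b * (_ * F y)]mulrCA; congr (_ + _).
rewrite powRM ?powR_ge0 ?ltW ?(sol_pos sol) ?ltW // -powRrM.
rewrite [X in _ = _ * X]mulrA -powRD ?(gt_eqF sy) ?implybT // subrK.
by rewrite powRD ?(gt_eqF sy) ?implybT // powRr1 ?ltW //; ring.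
Qed.

Hypotheses (K0 : 0 < K) (b0 : 0 < b) (p_ge : b + 1 <= b * p) (c0 : 0 < c).

Lemma p_gt0 : 0 < p.
Proof. by rewrite -(pmulr_rgt0 _ b0); apply: lt_le_trans p_ge; rewrite addr_gt0. Qed.

Lemma inversion_snd (L : R) y : 0 < L -> 0 < sqn y -> (0 < (inversion L y).2) = (0 < y.2).
Proof. by move=> L0 s0; rewrite /inversion /= pmulr_rgt0 // divr_gt0. Qed.

Lemma inversion_gap_interior (L : R) y : 0 < L -> L < sqn y -> 0 < y.2 ->
  inversion_gap L y < 0 ->
  (forall z, L <= sqn z -> 0 <= z.2 -> inversion_gap L y <= inversion_gap L z) -> False.
Proof.
move=> L0 Ly y0 neg ymin; set y' := inversion L y.
have s0 : 0 < sqn y by lra.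
have y'0 : 0 < y'.2 by rewrite inversion_snd.
have [A [Bm [[b3 dU] rU E]]] := cyl_decomposition y' y'0.
have lapl : cyl_laplacian y' <= cyl_laplacian y.
  rewrite -E; apply: (@interior_min_laplacian (fun z => cyl (inversion L z)) A (- b3) Bm y y0).
  - have := near_half_annulus L y Ly y0; apply: filterS => z [Lz z0]; exact: ymin.
  - rewrite (_ : (fun s => _) = fun s => cyl (expR (- s) *: y')); first exact: d2_opp dU.
    by apply/funext => s; rewrite inversion_dilation.
  - move=> d e ed; have [b2 h] := rU d e ed; exists b2; move: h.
    by congr has_d2; apply/funext => s; rewrite inversion_rotation.
have s'0 : 0 < sqn y' by exact: pos_sqn_gt0.
have s's : sqn y' <= sqn y.
  by rewrite sqn_inversion // ler_pdivrMr // -expr2 ler_pXn2r ?nnegrE ?ltW.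
have U'U : cyl y < cyl y' by move: neg; rewrite /inversion_gap subr_lt0.
have cyl0 z : 0 < z.2 -> 0 <= cyl z.
  by move=> z0; rewrite /cyl mulr_ge0 ?powR_ge0 ?ltW ?(sol_pos sol) ?ltW.
move: lapl; rewrite !cyl_laplacianE // leNgt => /negP; apply.
have i1 : sqn y `^ (b + 1 - b * p) <= sqn y' `^ (b + 1 - b * p).
  rewrite (_ : b + 1 - b * p = - (b * p - b - 1)); last by ring.
  rewrite !powRN lef_pV2 ?posrE ?powR_gt0 //.
  apply: ge0_ler_powR; rewrite ?nnegrE ?sqn_ge0 //; by rewrite -addrA -opprD subr_ge0.
have i2 : cyl y `^ p <= cyl y' `^ p.
  by apply: ge0_ler_powR; rewrite ?nnegrE ?cyl0 //; apply: ltW => //; exact: p_gt0.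
apply: ler_ltD; last by rewrite ltr_pM2l // exprn_gt0 // mulr_gt0.
by rewrite ler_pM2l //; apply: ler_pM => //; exact: powR_ge0.
Qed.

(* For [y] on the boundary and [h = |y|] this is a circular arc into the half-space. *)
Definition tilt (h tau : R) y : X := (cos tau *: y.1, sin tau * h).

Lemma sqn_tilt (h tau : R) y : y.2 = 0 -> h ^+ 2 = sqn y -> sqn (tilt h tau y) = sqn y.
Proof.
move=> y0 hy; rewrite {1}/sqn (bigD1 None) //= exprMn hy.
have E : \sum_(d : D | d != None) pcoord d (tilt h tau y) ^+ 2 = cos tau ^+ 2 * sqn y.
  rewrite /sqn [in RHS](bigD1 None) //= y0 expr0n /= add0r mulr_sumr.
  by apply: eq_bigr => -[i|//] _; rewrite /= mxE exprMn.
by rewrite E -mulrDl addrC cos2Dsin2 mul1r.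
Qed.

(** The arc stays on a sphere, so radial weights are constants [A1] and [A2], and its velocity at
    the boundary is [h] times the normal. As [has_grad] is silent on the boundary, the derivative is
    taken for [sin s > 0] only, and continuity of [psi] at [0] supplies its sign. *)
Lemma tilt_decrease (h m A1 A2 : R) y : y.2 = 0 -> 0 < h -> 0 < m ->
  A1 * (h * G None y) - A2 * (m * h * G None (m *: y)) < 0 ->
  exists tau, 0 < sin tau /\
    A1 * F (tilt h tau y) - A2 * F (m *: tilt h tau y) < A1 * F y - A2 * F (m *: y).
Proof.
move=> y0 h0 m0 neg.
have t0 : tilt h 0 y = y.
  by apply: ptP => -[i|]; rewrite /tilt /= ?cos0 ?sin0 ?scale1r ?mul0r ?y0.
pose c1 d (s : R) := if d is Some i then - sin s * pcoord d y else cos s * h.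
have dt d (s : R) : is_derive s 1 (fun s => pcoord d (tilt h s y)) (c1 d s).
  case: d => [i|] /=.
    rewrite (_ : (fun s => _) = fun s => cos s * pcoord (Some i) y); last first.
      by apply/funext => t; rewrite /= mxE.
    by apply: der_eq (derM (is_derive_cos s) (derC s _)) _; rewrite /=; ring.
  by apply: der_eq (derM (is_derive_sin s) (derC s _)) _; ring.
have dmt d (s : R) : is_derive s 1 (fun s => pcoord d (m *: tilt h s y)) (m * c1 d s).
  rewrite (_ : (fun s => _) = fun s => m * pcoord d (tilt h s y)); first exact: derZ.
  by apply/funext => t; rewrite pcoordZ.
pose phi s := A1 * F (tilt h s y) - A2 * F (m *: tilt h s y).
pose psi s := A1 * (\sum_d G d (tilt h s y) * c1 d s)
            - A2 * (\sum_d G d (m *: tilt h s y) * (m * c1 d s)).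
have dphi (s : R) : 0 < sin s -> is_derive s 1 phi (psi s).
  move=> s0; apply: derB; apply: derZ; apply: chain_rule => //.
  - by rewrite /= mulr_gt0.
  - by move=> d; exact: Gc.
  - by rewrite /= !mulr_gt0.
  - by move=> d; exact: Gc.
have tc (s : R) : tilt h t y @[t --> s] --> tilt h s y := curve_cvg _ _ _ (dt^~ s).
have mtc (s : R) : m *: tilt h t y @[t --> s] --> m *: tilt h s y := curve_cvg _ _ _ (dmt^~ s).
have phic : continuous phi.
  move=> s; apply: cvgB; apply: cvgM; try exact: cvg_cst.
    exact: (cvg_comp _ _ (tc s) (sol_cont sol _)).
  exact: (cvg_comp _ _ (mtc s) (sol_cont sol _)).
have c1c d : {for 0, continuous (c1 d)}.
  case: d => [i|]; rewrite /c1; apply: cvgM; try exact: cvg_cst.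
    by apply: cvgN; exact: continuous_sin.
  exact: continuous_cos.
have psic : {for 0, continuous psi}.
  apply: cvgB; apply: cvgM; try exact: cvg_cst.
    apply: cvg_sumr => d; apply: cvgM; last exact: c1c.
    exact: (cvg_comp _ _ (tc 0) (Gc d _)).
  apply: cvg_sumr => d; apply: cvgM; first exact: (cvg_comp _ _ (mtc 0) (Gc d _)).
  by apply: cvgM; [exact: cvg_cst | exact: c1c].
have S (g : D -> X -> R) z (a : R) : \sum_d g d z * (a * c1 d 0) = a * h * g None z.
  rewrite (bigD1 None) //= big1 ?cos0 ?addr0; first by ring.
  by case=> [i|//] _; rewrite /= sin0 oppr0 mul0r !mulr0.
have psi0 : psi 0 < 0.
  have S1 := S G y 1; rewrite mul1r in S1.
  move: neg; rewrite /psi t0 (S G) -S1; congr (_ * _ - _ < _).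
  by apply: eq_bigr => d _; rewrite mul1r.
have /nbhs_ballP[r /= r0 hr] : \forall s \near (0 : R), psi s < 0.
  exact: (cvgr_lt _ psic).
(* The bound by [1] keeps [sin] positive on the whole arc. *)
pose tau := Num.min (r / 2) 1.
have tau0 : 0 < tau by rewrite /tau lt_min ltr01 andbT; lra.
have taur : tau < r.
  by apply: (@le_lt_trans _ _ (r / 2)); [rewrite /tau ge_min lexx | lra].
have sin_pos s : 0 < s -> s <= tau -> 0 < sin s.
  move=> s0 st; apply: sin2_gt0; rewrite s0 /=; apply: le_lt_trans st _.
  by rewrite /tau gt_min; apply/orP; right; lra.
exists tau; split; first exact: sin_pos.
have [||s hs E] := @MVT _ phi psi 0 tau tau0.
- by move=> s; rewrite in_itv /= => /andP[s0 st]; apply: dphi; apply: sin_pos => //; exact: ltW.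
- by apply: continuous_subspaceT.
move: hs; rewrite in_itv /= => /andP[s0 st].
have : psi s < 0 by apply: hr; rewrite /ball /= sub0r normrN gtr0_norm //; lra.
move=> neg'; have : psi s * (tau - 0) < 0 by rewrite subr0 nmulr_rlt0.
by rewrite -E /phi t0; lra.
Qed.

End Comparison.

(** * Negative minima on the boundary *)

Section BoundaryTouching.
Context {R : realType} {k : nat}.
Local Notation X := ('rV[R]_k * R)%type.
Local Notation D := (option 'I_k).
Implicit Types (y z : X) (d e : D).
Variables (F : X -> R) (G : D -> X -> R) (H : D -> D -> X -> R).
Variables (K p q c b : R).
Hypothesis sol : halfspace_solution K p q c F G H.
Hypothesis kb : k%:R = 4 * b + 1.
Hypotheses (K0 : 0 < K) (b0 : 0 < b) (p_ge : b + 1 <= b * p) (c0 : 0 < c).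
Local Notation U := (cyl F b).

Lemma powR_continuous (a x : R) : 0 < x -> {for x, continuous (fun x => x `^ a)}.
Proof. by move=> x0; have := is_derive_continuous (is_derive1_powR a x0). Qed.

Lemma cyl_continuous y : 0 < sqn y -> {for y, continuous U}.
Proof.
move=> y0; apply: cvgM; last exact: (sol_cont sol).
exact: (cvg_comp _ _ (@sqn_continuous _ _ y) (powR_continuous _ _ y0)).
Qed.

Lemma cyl_gt0 y : 0 <= y.2 -> 0 < sqn y -> 0 < U y.
Proof. by move=> y0 s0; rewrite mulr_gt0 ?powR_gt0 ?(sol_pos sol). Qed.

Lemma sqn_inversion_gt0 (L : R) y : 0 < L -> 0 < sqn y -> 0 < sqn (inversion L y).
Proof. by move=> L0 s0; rewrite sqn_inversion // divr_gt0 // exprn_gt0. Qed.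

Lemma inversion_gap_continuous (L : R) y : 0 < L -> L <= sqn y ->
  {for y, continuous (inversion_gap F b L)}.
Proof.
move=> L0 Ly; have s0 : 0 < sqn y by lra.
apply: cvgB; first exact: cyl_continuous.
exact: (cvg_comp _ _ (inversion_continuous L y s0)
  (cyl_continuous _ (sqn_inversion_gt0 L y L0 s0))).
Qed.

Lemma bounded_on_ball (M : R) : exists2 C, 0 < C & forall y, sqn y <= M -> F y <= C.
Proof.
case: (pselect ([set y : X | sqn y <= M] !=set0)) => [ne|e].
  have [|y _ hy] := @compact_EVT_max _ _ F _ ne (compact_sqn_le M).
    by apply: continuous_subspaceT; exact: (sol_cont sol).
  exists (`|F y| + 1); first by rewrite ltr_wpDl.
  move=> z zM; have : F z <= F y by apply: hy; rewrite inE.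
  by have := ler_norm (F y); lra.
by exists 1 => // y yM; case: e; exists y.
Qed.

(** The inverse of a far point is near the centre, where [F] is bounded and the weight with exponent
    [b > 0] is small; the other term is positive. *)
Lemma inversion_gap_far (L g : R) : 0 < L -> 0 < g -> exists M, forall y,
  L <= sqn y -> 0 <= y.2 -> M < sqn y -> - g <= inversion_gap F b L y.
Proof.
move=> L0 g0; have [C C0 FC] := bounded_on_ball L.
(* [w] solves [w ^ b * C = g]; it bounds the squared radius of the inverse. *)
pose w := (g / C) `^ b^-1.
have gC : 0 < g / C by rewrite divr_gt0.
have w0 : 0 < w by rewrite powR_gt0.
exists (L ^+ 2 / w) => y Ly y0 My.
have s0 : 0 < sqn y by lra.
have y'0 : 0 <= (inversion L y).2 by rewrite /inversion /= mulr_ge0 // divr_ge0 // ltW.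
have : U (inversion L y) <= g.
  have -> : g = w `^ b * C.
    by rewrite /w -powRrM mulVf ?lt0r_neq0 // powRr1 ?ltW // divfK // lt0r_neq0.
  rewrite /cyl sqn_inversion //; apply: ler_pM; rewrite ?powR_ge0 //.
  - exact: ltW (sol_pos sol _ y'0).
  - apply: ge0_ler_powR; rewrite ?nnegrE ?divr_ge0 ?sqr_ge0 //; try exact: ltW.
    by rewrite ler_pdivrMr // mulrC -ler_pdivrMr // ltW.
  - apply: FC; rewrite sqn_inversion // ler_pdivrMr // expr2.
    by rewrite ler_pM2l.
have := cyl_gt0 y y0 s0; rewrite /inversion_gap; lra.
Qed.

(** What the nonlinear boundary condition leaves at a negative minimum. The additional exponent
    [2^-1] is the speed [|y|] of the arc [tilt]. *)
Definition touching (L : R) y : Prop :=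
  [/\ y.2 = 0, L < sqn y &
   sqn y `^ (b + 2^-1) * F y `^ q <=
   sqn (inversion L y) `^ (b + 2^-1) * F (inversion L y) `^ q].

Lemma inversion_gap_touching (L : R) y0 : 0 < L -> L <= sqn y0 -> 0 <= y0.2 ->
  inversion_gap F b L y0 < 0 -> exists y, touching L y.
Proof.
move=> L0 Ly0 y02 neg; set g := inversion_gap F b L y0 in neg.
have g0 : 0 < - g by lra.
have [M hM] := inversion_gap_far L (- g) L0 g0.
have [||||y [Ly y2 yy0 ymin]] := @half_annulus_min _ _ (inversion_gap F b L) L M y0.
- by move=> y Ly; exact: inversion_gap_continuous.
- by [].
- by [].
- by move=> y Ly y2 My; have := hM y Ly y2 My; rewrite opprK.
have neg' : inversion_gap F b L y < 0 by exact: le_lt_trans yy0 neg.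
have s0 : 0 < sqn y by lra.
have Ly' : L < sqn y.
  rewrite lt_neqAle Ly andbT; apply/eqP => E; move: neg'.
  by rewrite /inversion_gap /inversion E divff ?lt0r_neq0 // scale1r subrr ltxx.
exists y; case: (ltgtP 0 y.2) y2 => // [y2 _|y2 _].
  exfalso; exact: (inversion_gap_interior F G H K p q c b sol kb K0 b0 p_ge L y L0 Ly' y2 neg' ymin).
(* If the inequality failed, the gap would have a negative derivative along the arc into the
   half-space, and a tilted point on the same sphere would lie below the minimum. *)
split => //; rewrite leNgt; apply/negP => bad.
set y' := inversion L y in bad; set h := sqn y `^ 2^-1; set m := L / sqn y.
have m0 : 0 < m by rewrite divr_gt0.
have h0 : 0 < h by rewrite powR_gt0.
have h2 : h ^+ 2 = sqn y.
  by rewrite -powR_mulrn ?ltW // -powRrM mulVf ?powRr1 ?ltW.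
have s'0 : 0 < sqn y' by exact: sqn_inversion_gt0.
have mh : m * h = sqn y' `^ 2^-1.
  rewrite /y' /inversion -/m sqnZ -h2 -exprMn powR12_sqrt ?sqr_ge0 //.
  by rewrite sqrtr_sqr gtr0_norm // mulr_gt0.
have := tilt_decrease F G H K p q c sol h m (sqn y `^ b) (sqn y' `^ b) y (esym y2) h0 m0.
have -> : m *: y = y' by [].
have y'2 : y'.2 = 0 by have := pcoordZ None m y; rewrite [pcoord _ y]/= -y2 mulr0.
rewrite (sol_bd sol y (esym y2)) (sol_bd sol y' y'2) mh.
case=> [|tau [st]].
  have pD z : 0 < sqn z -> sqn z `^ (b + 2^-1) = sqn z `^ b * sqn z `^ 2^-1.
    by move=> z0; rewrite powRD // (gt_eqF z0) implybT.
  move: bad; rewrite !pD // -/h -subr_gt0.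
  set u := (X in 0 < X) => u0.
  rewrite [X in X < 0](_ : _ = - c * u); first by rewrite nmulr_rlt0 ?oppr_lt0.
  by rewrite /u; ring.
have sE := sqn_tilt h tau y (esym y2) h2.
have t2 : 0 <= (tilt h tau y).2 by rewrite /= mulr_ge0 // ltW.
have := ymin (tilt h tau y); rewrite sE => /(_ Ly t2); rewrite leNgt => /negP h3 h4.
apply: h3; move: h4.
rewrite /inversion_gap /cyl sE -/y'.
have -> : inversion L (tilt h tau y) = m *: tilt h tau y by rewrite /inversion sE.
by rewrite sqnZ sE -sqnZ.
Qed.

Lemma cyl_min_annulus (a M : R) : 0 < a -> exists2 m, 0 < m &
  forall y, a <= sqn y -> sqn y <= M -> 0 <= y.2 -> m <= U y.
Proof.
move=> a0; pose A : set X := [set y | sqn y <= M] `&` [set y | a <= sqn y /\ 0 <= y.2].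
have cA : compact A by apply: compact_closedI; [exact: compact_sqn_le | exact: closed_half_annulus].
case: (pselect (A !=set0)) => [ne|e]; last first.
  by exists 1 => // y ay yM y0; case: e; exists y.
have [|y] := @compact_EVT_min _ _ U A ne cA.
  by apply: continuous_in_subspaceT => y; rewrite inE => -[_ [ay _]]; apply: cyl_continuous; lra.
rewrite inE => -[_ [ay y2]] ymin; exists (U y); first by apply: cyl_gt0 => //; lra.
by move=> z az zM z2; apply: ymin; rewrite inE.
Qed.

End BoundaryTouching.

(** * Decay at infinity *)

Section DecayBound.
Context {R : realType} {k : nat}.
Local Notation X := ('rV[R]_k * R)%type.
Local Notation D := (option 'I_k).
Implicit Types (y z : X) (d e : D).
Variables (F : X -> R) (G : D -> X -> R) (H : D -> D -> X -> R).
Variables (K p q c b : R).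
Hypothesis sol : halfspace_solution K p q c F G H.
Hypothesis kb : k%:R = 4 * b + 1.
Hypotheses (K0 : 0 < K) (b0 : 0 < b) (p_ge : b + 1 <= b * p) (c0 : 0 < c).
Local Notation U := (cyl F b).

(* In Euclidean terms [r ^ (- 2 b) + r ^ (- 2 b - 1)]: the second power is what makes the
   barrier a strict subsolution. *)
Definition radial_barrier (eps delta n : R) : R :=
  eps * (n `^ (- b) + n `^ (- (b + 2^-1))) - delta.

Lemma d2_radial_barrier (eps delta : R) y :
  has_d2 (fun s => radial_barrier eps delta (sqn (expR s *: y)))
    (eps * (sqn y `^ (- b) * (- (2 * b)) + sqn y `^ (- (b + 2^-1)) * (- (2 * b + 1))) - 0)
    (eps * (sqn y `^ (- b) * (2 * b) ^+ 2 + sqn y `^ (- (b + 2^-1)) * (2 * b + 1) ^+ 2) - 0).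
Proof.
rewrite (_ : (fun s => _) = fun s => eps * (sqn y `^ (- b) * expR (- (2 * b) * s) +
   sqn y `^ (- (b + 2^-1)) * expR (- (2 * b + 1) * s)) - delta).
  rewrite -[(2 * b) ^+ 2]sqrrN -[(2 * b + 1) ^+ 2]sqrrN.
  exact: d2B (d2Z _ (d2D (d2Z _ (d2_expRM _)) (d2Z _ (d2_expRM _)))) (d2C _).
apply/funext => s; rewrite /radial_barrier !powR_sqn_expRZ.
congr (_ * (_ * expR (_ * s) + _ * expR (_ * s)) - _); first by ring.
by field.
Qed.

Lemma radial_barrier_far (eps delta : R) : 0 < eps -> 0 < delta ->
  exists M, forall n, M < n -> radial_barrier eps delta n <= 0.
Proof.
move=> e0 d0.
(* Beyond [1] the second power is the smaller one, so both are controlled by [n ^ (- b)]; the other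
   bound makes [2 * eps * n ^ (- b)] at most [delta]. *)
pose M := Num.max 1 ((2 * eps / delta) `^ b^-1).
exists M => n; rewrite /M gt_max => /andP[n1 nM].
have n0 : 0 < n by lra.
have i1 : n `^ (- (b + 2^-1)) <= n `^ (- b).
  by apply: ler_powR; lra.
have i2 : eps * (2 * n `^ (- b)) <= delta.
  have w0 : 0 < 2 * eps / delta by rewrite divr_gt0 // mulr_gt0.
  have : 2 * eps / delta <= n `^ b.
    rewrite [leLHS](_ : _ = ((2 * eps / delta) `^ b^-1) `^ b).
      by apply: ge0_ler_powR; rewrite ?nnegrE ?powR_ge0 //; exact: ltW.
    by rewrite -powRrM mulVf ?lt0r_neq0 // powRr1 // ltW.
  rewrite ler_pdivrMr // powRN mulrA ler_pdivrMr ?powR_gt0 //.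
  by rewrite mulrC [delta * _]mulrC.
rewrite /radial_barrier subr_le0; apply: le_trans i2.
by rewrite ler_pM2l //; lra.
Qed.

(** Subtracting [delta] makes the barrier nonpositive at infinity, so that the difference has a
    minimum if it is negative anywhere; [delta] is then arbitrary. At a boundary minimum the tilt
    lowers [F] and keeps the barrier fixed. In the interior, the excess [(2 * b + 1) ^+ 2 - (2 * b)
    ^+ 2 = 4 * b + 1] of the second power absorbs the nonlinear term. *)
Lemma cyl_decay : exists2 eps, 0 < eps &
  forall y, 1 <= sqn y -> 0 <= y.2 -> eps * sqn y `^ (- b) <= U y.
Proof.
have K_gt0 := K0; have b_gt0 := b0; have p_ge1 := p_ge.
have p1 : 0 < p - 1.
  by rewrite subr_gt0 -(ltr_pM2l b0) mulr1; apply: lt_le_trans p_ge; lra.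
have [m m0 mU] := cyl_min_annulus F G H K p q c b sol 1 1 ltr01.
have q0 : 0 < (4 * b + 1) / (2 * K) by rewrite divr_gt0 //; lra.
have [w w0 wE] : exists2 w, 0 < w & w `^ (p - 1) = (4 * b + 1) / (2 * K).
  exists (((4 * b + 1) / (2 * K)) `^ (p - 1)^-1); first by rewrite powR_gt0.
  by rewrite -powRrM mulVf ?lt0r_neq0 // powRr1 // ltW.
(* The bound by [w] keeps the nonlinear term below the excess [4 * b + 1]; the bound by [m] excludes
   the unit sphere, where the barrier is below [2 * eps]. *)
have [eps [e0 ew em]] : exists eps, [/\ 0 < eps, 2 * eps <= w & 2 * eps <= m].
  exists (Num.min (w / 2) (m / 2)); rewrite lt_min !divr_gt0 //.
  have : Num.min (w / 2) (m / 2) <= w / 2 by rewrite ge_min lexx.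
  have : Num.min (w / 2) (m / 2) <= m / 2 by rewrite ge_min lexx orbT.
  by split => //; lra.
have {}ew : 2 * K * (2 * eps) `^ (p - 1) <= 4 * b + 1.
  rewrite mulrC -ler_pdivlMr; last by lra.
  by rewrite -wE; apply: ge0_ler_powR; rewrite ?nnegrE; lra.
exists eps => // y0 y01 y02.
suff main delta : 0 < delta -> radial_barrier eps delta (sqn y0) <= U y0.
  have h0 : 0 <= eps * sqn y0 `^ (- (b + 2^-1)) by rewrite mulr_ge0 ?powR_ge0 ?ltW.
  apply/ler_addgt0Pr => delta d0; have := main delta d0.
  by rewrite /radial_barrier mulrDr; lra.
move=> d0; rewrite -subr_ge0 leNgt; apply/negP => neg.
have [M hM] := radial_barrier_far eps delta e0 d0.
pose v y := U y - radial_barrier eps delta (sqn y).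
have [||||y [y1 y2 vy ymin]] := @half_annulus_min _ _ v 1 M y0; rewrite ?y01 //.
- move=> y y1; have s0 : 0 < sqn y by lra.
  apply: cvgB; first exact: (cyl_continuous F G H K p q c b sol).
  apply: cvgB; last exact: cvg_cst.
  apply: cvgM; first exact: cvg_cst.
  by apply: cvgD; exact: (cvg_comp _ _ (@sqn_continuous _ _ y) (powR_continuous _ _ s0)).
- move=> y y1 y2 My; have := hM _ My.
  have : 0 < U y by apply: (cyl_gt0 F G H K p q c b sol) => //; lra.
  by rewrite /v; lra.
have s0 : 0 < sqn y by lra.
have neg' : U y < radial_barrier eps delta (sqn y) by move: neg vy; rewrite /v; lra.
have n1 a : a <= 0 -> sqn y `^ a <= 1.
  by move=> a0; rewrite -[leRHS](powRr0 (sqn y)); exact: ler_powR.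
have Uub : U y <= 2 * eps * sqn y `^ (- b).
  apply: ltW; apply: lt_le_trans neg' _; rewrite /radial_barrier.
  have : sqn y `^ (- (b + 2^-1)) <= sqn y `^ (- b) by apply: ler_powR; lra.
  by rewrite -(ler_pM2l e0); lra.
have y1' : 1 < sqn y.
  rewrite lt_neqAle y1 andbT; apply/eqP => E.
  have Um : m <= U y by apply: mU; rewrite -?E.
  move: neg'; rewrite /radial_barrier -E !powR1; lra.
case: (ltgtP 0 y.2) y2 => // [y2 _|y2 _].
  have ynear : \forall z \near y, v y <= v z.
    have := near_half_annulus 1 y y1' y2; apply: filterS => z [z1 z2]; exact: ymin.
  have rd d e : e != d -> exists b2, has_d2
      (fun s => radial_barrier eps delta (sqn (rotation d e s y))) b2 0.
    move=> ed; exists 0.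
    rewrite (_ : (fun s => _) = fun=> radial_barrier eps delta (sqn y)); first exact: d2C.
    by apply/funext => s; rewrite sqn_rotation.
  have lapl := interior_min_laplacian F G H K p q c b sol kb
    (fun z => radial_barrier eps delta (sqn z)) _ _ (fun _ _ => 0) y y2 ynear
    (d2_radial_barrier eps delta y) rd.
  move: lapl; rewrite (cyl_laplacianE F G H K p q c b sol) //.
  rewrite [\sum_d _]big1 ?mulr0 ?addr0; last by move=> d _; rewrite big1.
  rewrite subr0 leNgt => /negP; apply.
  have b2 : 0 < (2 * b) ^+ 2 by rewrite exprn_gt0 // mulr_gt0.
  have i3 : (2 * b) ^+ 2 * U y <
      (2 * b) ^+ 2 * (eps * (sqn y `^ (- b) + sqn y `^ (- (b + 2^-1)))).
    by rewrite ltr_pM2l //; move: neg'; rewrite /radial_barrier; lra.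
  have i4 : K * (sqn y `^ (b + 1 - b * p) * U y `^ p) <=
      eps * ((4 * b + 1) * sqn y `^ (- (b + 2^-1))).
    have U0 : 0 < U y by apply: (cyl_gt0 F G H K p q c b sol) => //; exact: ltW.
    apply: (@le_trans _ _ (K * (sqn y `^ (b + 1 - b * p) * (2 * eps * sqn y `^ (- b)) `^ p))).
      rewrite ler_pM2l // ler_pM2l ?powR_gt0 //.
      apply: ge0_ler_powR; rewrite ?nnegrE ?(ltW U0) //; first by lra.
      exact: le_trans (ltW U0) Uub.
    rewrite powRM ?powR_ge0 //; last by lra.
    rewrite -powRrM.
    have -> : K * (sqn y `^ (b + 1 - b * p) * ((2 * eps) `^ p * sqn y `^ (- b * p))) =
       K * (2 * eps) `^ p * sqn y `^ (b + 1 - b * p - b * p).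
      by rewrite [in RHS]powRB ?(gt_eqF s0) ?implybT // mulNr powRN; ring.
    have -> : (2 * eps) `^ p = 2 * eps * (2 * eps) `^ (p - 1).
      by rewrite mulr_powRB1 //; lra.
    have -> : K * (2 * eps * (2 * eps) `^ (p - 1)) = eps * (2 * K * (2 * eps) `^ (p - 1)).
      by ring.
    rewrite -[leLHS]mulrA ler_pM2l //; apply: ler_pM; rewrite ?powR_ge0 //.
      by rewrite !mulr_ge0 ?powR_ge0 //; lra.
    (* The exponents compare because [2 * b * p >= 2 * b + 2]. *)
    by apply: ler_powR => //; lra.
  have -> : eps * (sqn y `^ (- b) * (2 * b) ^+ 2 + sqn y `^ (- (b + 2^-1)) * (2 * b + 1) ^+ 2)
    = eps * ((4 * b + 1) * sqn y `^ (- (b + 2^-1))) +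
      (2 * b) ^+ 2 * (eps * (sqn y `^ (- b) + sqn y `^ (- (b + 2^-1)))) by ring.
  exact: ler_ltD.
pose h := sqn y `^ 2^-1.
have h0 : 0 < h by rewrite powR_gt0.
have h2 : h ^+ 2 = sqn y.
  by rewrite -powR_mulrn ?ltW // -powRrM mulVf ?powRr1 ?ltW.
(* [A2 = 0] removes the reflected term. *)
have [|tau [st]] := tilt_decrease F G H K p q c sol h 1 (sqn y `^ b) 0 y (esym y2) h0 ltr01.
  rewrite mul0r subr0 (sol_bd sol y (esym y2)) pmulr_rlt0 ?powR_gt0 // pmulr_rlt0 //.
  by rewrite nmulr_rlt0 ?oppr_lt0 // powR_gt0 // (sol_pos sol) // -y2.
have sE := sqn_tilt h tau y (esym y2) h2.
have t2 : 0 <= (tilt h tau y).2 by rewrite /= mulr_ge0 // ltW.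
have := ymin (tilt h tau y); rewrite sE => /(_ y1 t2) h3; move: h3.
by rewrite /v sE /cyl sE !mul0r !subr0 lerD2r => h3 h4; move: h4; rewrite ltNge h3.
Qed.

End DecayBound.

(** * Moving the spheres *)

Section RadialMonotonicity.
Context {R : realType} {k : nat}.
Local Notation X := ('rV[R]_k * R)%type.
Local Notation D := (option 'I_k).
Implicit Types (y z : X) (d e : D).
Variables (F : X -> R) (G : D -> X -> R).
Hypotheses (Fc : continuous F) (Gc : forall d, continuous (G d)) (FG : has_grad F G).

(** The derivative of [cyl F a] along dilations without its positive weight. In this form it is
    continuous everywhere, and at the centre it equals [2 * a * F 0]. *)
Definition dilation_slope (a : R) y : R := 2 * a * F y + \sum_d G d y * pcoord d y.

Lemma dilation_slope_continuous a : continuous (dilation_slope a).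
Proof.
move=> y; apply: cvgD; first by apply: cvgM; [exact: cvg_cst | exact: Fc].
by apply: cvg_sumr => d; apply: cvgM; [exact: Gc | exact: pcoord_continuous].
Qed.

Lemma der_cyl_dilation (a s : R) y : 0 < y.2 ->
  is_derive s 1 (fun s => cyl F a (expR s *: y))
    (sqn y `^ a * expR (2 * a * s) * dilation_slope a (expR s *: y)).
Proof.
move=> y0; rewrite (_ : (fun s => _) = fun s =>
    sqn y `^ a * (expR ((2 * a) * s) * F (expR s *: y))); last first.
  by apply/funext => t; rewrite /cyl powR_sqn_expRZ mulrA.
have dF : is_derive s 1 (fun s => F (expR s *: y))
    (\sum_d G d (expR s *: y) * (expR s * pcoord d y)).
  apply: chain_rule => //; first by rewrite /= mulr_gt0 ?expR_gt0.
    by move=> d; exact: Gc.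
  by move=> d; exact: der_dilation.
apply: der_eq (derZ _ (derM (der_expRM (2 * a) s) dF)) _.
have E : \sum_d G d (expR s *: y) * (expR s * pcoord d y) =
    \sum_d G d (expR s *: y) * pcoord d (expR s *: y).
  by apply: eq_bigr => d _; rewrite pcoordZ.
by rewrite E /dilation_slope; ring.
Qed.

Lemma cyl_dilation_le (a m : R) y : 0 < y.2 -> 1 <= m ->
  (forall s, 1 <= s -> s <= m -> 0 <= dilation_slope a (s *: y)) ->
  cyl F a y <= cyl F a (m *: y).
Proof.
move=> y0 m1 W0.
have m0 : 0 < m by lra.
have lm : 0 <= ln m by rewrite ln_ge0.
have cU : {within `[0, ln m], continuous (fun s => cyl F a (expR s *: y))}.
  apply: continuous_subspaceT => s; exact: is_derive_continuous (der_cyl_dilation a s y y0).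
have [s hs E] := MVT_segment lm (fun s _ => der_cyl_dilation a s y y0) cU.
have E1 : expR (ln m) = m by exact: lnK.
move: E; rewrite E1 expR0 scale1r -subr_ge0 => ->.
move: hs; rewrite in_itv /= => /andP[s0 sm].
apply: mulr_ge0; last by rewrite subr0.
apply: mulr_ge0; first by rewrite mulr_ge0 ?powR_ge0 ?expR_ge0.
apply: W0; first by rewrite -[leLHS]expR0 ler_expR.
by rewrite -[leRHS]E1 ler_expR.
Qed.

Lemma gt0_cyl_continuous (a : R) y : 0 < sqn y -> {for y, continuous (cyl F a)}.
Proof.
move=> y0; apply: cvgM; last exact: Fc.
exact: (cvg_comp _ _ (@sqn_continuous _ _ y) (powR_continuous _ _ y0)).
Qed.

(** The ray through [z] lies in the boundary, where no derivative along it is available. Lifting [z]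
    by a small height gives an interior ray in the same box, and the inequality passes to the
    limit. *)
Lemma cyl_dilation_le_near (a m e : R) z0 z : 0 < e ->
  (forall y, (forall d, `|pcoord d z0 - pcoord d y| < e) -> 0 <= dilation_slope a y) ->
  0 < sqn z -> z.2 = 0 -> 1 <= m ->
  (forall d, `|pcoord d z0 - pcoord d z| < e) ->
  (forall d, `|pcoord d z0 - pcoord d (m *: z)| < e) ->
  cyl F a z <= cyl F a (m *: z).
Proof.
move=> e0 W0 s0 z2 m1 z_in mz_in.
have m0 : 0 < m by lra.
rewrite -subr_ge0 leNgt; apply/negP => neg.
pose up (t : R) : X := z + t *: dirv None.
have upE d t : pcoord d (up t) = pcoord d z + t * (d == None)%:R.
  by rewrite pcoordD pcoordZ pcoord_dirv.
have up0 : up 0 = z by rewrite /up scale0r addr0.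
have upc : up t @[t --> (0 : R)] --> z.
  rewrite -[X in _ --> X]up0; apply: cvg_pt => d; rewrite upE.
  rewrite (_ : (fun t => _) = fun t => pcoord d z + t * (d == None)%:R); last first.
    by apply/funext => t; rewrite upE.
  by apply: cvgD; [exact: cvg_cst | apply: cvgM; [exact: cvg_id | exact: cvg_cst]].
have mupc : m *: up t @[t --> (0 : R)] --> m *: z.
  apply: cvg_pt => d; rewrite pcoordZ.
  rewrite (_ : (fun t => _) = fun t => m * pcoord d (up t)); last first.
    by apply/funext => t; rewrite pcoordZ.
  apply: cvgM; first exact: cvg_cst.
  exact: (cvg_comp _ _ upc (@pcoord_continuous _ _ d z)).
have in_nbhs y : (forall d, `|pcoord d z0 - pcoord d y| < e) ->
    nbhs y [set y | forall d, `|pcoord d z0 - pcoord d y| < e].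
  move=> y_in.
  have H d : \forall z \near y, `|pcoord d z0 - pcoord d z| < e.
    have cv : `|pcoord d z0 - pcoord d z| @[z --> y] --> `|pcoord d z0 - pcoord d y|.
      apply: cvg_norm; apply: cvgB; first exact: cvg_cst.
      exact: pcoord_continuous.
    exact: (cvgr_lt _ cv _ (y_in d)).
  exact: (@filter_forall _ _ _ _ (nbhs_filter y) H).
have sm0 : 0 < sqn (m *: z) by rewrite sqnZ mulr_gt0 // exprn_gt0.
have : \forall t \near (0 : R), [/\ cyl F a (m *: up t) - cyl F a (up t) < 0,
    (forall d, `|pcoord d z0 - pcoord d (up t)| < e) &
    (forall d, `|pcoord d z0 - pcoord d (m *: up t)| < e)].
  near=> t; split; near: t.
  - have cv : cyl F a (m *: up t) - cyl F a (up t) @[t --> (0 : R)] -->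
        cyl F a (m *: z) - cyl F a z.
      apply: cvgB; first exact: (cvg_comp _ _ mupc (gt0_cyl_continuous a _ sm0)).
      exact: (cvg_comp _ _ upc (gt0_cyl_continuous a _ s0)).
    exact: (cvgr_lt _ cv _ neg).
  - exact: upc _ (in_nbhs _ z_in).
  - exact: mupc _ (in_nbhs _ mz_in).
move=> /nbhs_ballP[r /= r0 /(_ (r / 2))]; rewrite /ball /= sub0r normrN gtr0_norm ?divr_gt0 //.
rewrite ltr_pdivrMr // ltr_pMr // ltr1n => /(_ isT) [].
have u2 : 0 < pcoord None (up (r / 2)).
  by rewrite upE [pcoord _ z]z2 eqxx mulr1 add0r divr_gt0.
rewrite subr_lt0 ltNge => /negP n1 h1 h2; apply: n1.
apply: cyl_dilation_le => // s s1 sm; apply: W0 => d.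
(* The box contains the segment between its two ends: a coordinate of [s *: up _] lies between the
   end values, in an order that depends on its sign. *)
rewrite pcoordZ; have := h1 d; have := h2 d; rewrite pcoordZ.
move: (pcoord d (up _)) (pcoord d z0) => w w0.
rewrite !ltr_norml => /andP[? ?] /andP[? ?].
case: (leP 0 w) => hw.
  have i1 : w <= s * w by rewrite ler_peMl.
  have i2 : s * w <= m * w by rewrite ler_wpM2r.
  by apply/andP; split; lra.
have i1 : s * w <= w by rewrite ler_neMl // ltW.
have i2 : m * w <= s * w by rewrite ler_wnM2r // ltW.
by apply/andP; split; lra.
Unshelve. all: by end_near. Qed.

Lemma tilt_cvg0 (h : R) y : y.2 = 0 -> tilt h t y @[t --> (0 : R)] --> y.
Proof.
move=> y0; apply: cvg_pt => -[i|] /=.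
  rewrite (_ : (fun t => _) = fun t => cos t * y.1 0 i); last by apply/funext => t; rewrite mxE.
  rewrite -[X in _ --> X]mul1r -cos0.
  by apply: cvgM; [exact: continuous_cos | exact: cvg_cst].
have s0 : sin t @[t --> (0 : R)] --> sin (0 : R) by exact: continuous_sin.
rewrite sin0 in s0; rewrite y0 -[X in _ --> X](mul0r h).
by apply: cvgM => //; exact: cvg_cst.
Qed.

End RadialMonotonicity.

Section MovingSpheres.
Context {R : realType} {k : nat}.
Local Notation X := ('rV[R]_k * R)%type.
Local Notation D := (option 'I_k).
Implicit Types (y z : X) (d e : D).
Variables (F : X -> R) (G : D -> X -> R) (H : D -> D -> X -> R).
Variables (K p q c b : R).
Hypothesis sol : halfspace_solution K p q c F G H.
Hypothesis kb : k%:R = 4 * b + 1.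
Hypotheses (K0 : 0 < K) (b0 : 0 < b) (p_ge : b + 1 <= b * p) (c0 : 0 < c).
Hypotheses (q_ge1 : 1 <= q) (q_lt : b * q < b + 2^-1).
Local Notation U := (cyl F b).

(** Taking the [q]-th root of the inequality in [touching] gives one for [cyl F beta], so [2 * beta]
    is the larger exponent announced in the overview. *)
Let beta : R := (b + 2^-1) / q.

Let q0 : 0 < q. Proof. exact: lt_le_trans q_ge1. Qed.

Let b_lt_beta : b < beta. Proof. by rewrite /beta ltr_pdivlMr. Qed.

Lemma inversionK (L : R) y : 0 < L -> 0 < sqn y -> inversion L (inversion L y) = y.
Proof.
move=> L0 y0; rewrite /inversion -/(inversion L y) sqn_inversion // scalerA.
rewrite -[RHS]scale1r; congr (_ *: _).
by field; rewrite !lt0r_neq0.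
Qed.

Lemma cyl_power (a a' : R) y : 0 < sqn y -> cyl F a' y = sqn y `^ (a' - a) * cyl F a y.
Proof. by move=> y0; rewrite /cyl mulrA -powRD ?(gt_eqF y0) ?implybT // subrK. Qed.

(** Raising the weight multiplies by a positive power of the radius, strictly larger at the outer
    point. *)
Lemma cyl_power_lt (a a' : R) y z : a < a' -> 0 < sqn z -> sqn z < sqn y -> 0 <= z.2 ->
  cyl F a z <= cyl F a y -> cyl F a' z < cyl F a' y.
Proof.
move=> aa z0 zy z2 le1; have y0 : 0 < sqn y by exact: lt_trans zy.
have za : 0 < cyl F a z by rewrite mulr_gt0 ?powR_gt0 ?(sol_pos sol).
rewrite (cyl_power a a' z z0) (cyl_power a a' y y0).
apply: (@lt_le_trans _ _ (sqn y `^ (a' - a) * cyl F a z)).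
  rewrite ltr_pM2r //; apply: gt0_ltr_powR => //; rewrite ?nnegrE ?subr_gt0 //.
    exact: ltW.
  exact: ltW.
by rewrite ler_pM2l ?powR_gt0.
Qed.

Lemma touching_cyl_le (L : R) y : 0 < L -> touching F q b L y ->
  cyl F beta y <= cyl F beta (inversion L y).
Proof.
move=> L0 [y2 Ly]; have s0 : 0 < sqn y by exact: lt_trans Ly.
have y'2 : (inversion L y).2 = 0.
  by have := pcoordZ None (L / sqn y) y; rewrite [pcoord _ y]/= y2 mulr0.
have pq z : 0 <= z.2 -> sqn z `^ (b + 2^-1) * F z `^ q = cyl F beta z `^ q.
  move=> z2; rewrite powRM ?powR_ge0 //; last exact: ltW (sol_pos sol _ z2).
  by rewrite -powRrM /beta divfK // lt0r_neq0.
have cyl_ge0 z : 0 <= z.2 -> 0 <= cyl F beta z.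
  by move=> z2; rewrite mulr_ge0 ?powR_ge0 // ltW // (sol_pos sol).
rewrite !pq ?y2 ?y'2 // => h; rewrite leNgt; apply/negP => h1; move: h; apply/negP.
by rewrite -ltNge; apply: gt0_ltr_powR => //; rewrite nnegrE cyl_ge0 ?y2 ?y'2.
Qed.

(** The side conditions are premises, so that the predicate is vacuous off the boundary, outside the
    sphere and for [L <= 0]; it can then be asserted near every pair [(z, L)], as the compactness
    argument requires. *)
Definition sphere_ordered (L : R) z : Prop :=
  0 < L -> z.2 = 0 -> 0 < sqn z -> sqn z < L -> cyl F beta z < cyl F beta (inversion L z).

(** A negative gap produces a touching point outside the sphere. Its inverse lies inside, and the
    strict order there is opposite to the touching inequality. *)
Lemma sphere_ordered_gap (L : R) : 0 < L -> (forall z, sphere_ordered L z) ->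
  forall y, L <= sqn y -> 0 <= y.2 -> 0 <= inversion_gap F b L y.
Proof.
move=> L0 ord y Ly y2; rewrite leNgt; apply/negP => neg.
have [z tz] := inversion_gap_touching F G H K p q c b sol kb K0 b0 p_ge c0 L y L0 Ly y2 neg.
have := touching_cyl_le L z L0 tz; case: tz => z2 Lz _.
have s0 : 0 < sqn z by exact: lt_trans Lz.
have z'2 : (inversion L z).2 = 0.
  by have := pcoordZ None (L / sqn z) z; rewrite [pcoord _ z]/= z2 mulr0.
have := ord (inversion L z) L0 z'2 (sqn_inversion_gt0 L z L0 s0).
rewrite sqn_inversion // ltr_pdivrMr // expr2 ltr_pM2l // => /(_ Lz).
by rewrite inversionK // ltNge => /negP.
Qed.

(** Treats the pairs whose two points are both close to [z0]: near the centre for small spheres, and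
    near the sphere itself. *)
Lemma local_ordering (a : R) z0 : a < beta -> 0 < dilation_slope F G a z0 ->
  exists2 e, 0 < e & forall z m, z.2 = 0 -> 0 < sqn z -> 1 < m ->
    (forall d, `|pcoord d z0 - pcoord d z| < e) ->
    (forall d, `|pcoord d z0 - pcoord d (m *: z)| < e) ->
    cyl F beta z < cyl F beta (m *: z).
Proof.
move=> ab W0.
have /nbhs_pt [e e0 he] : \forall z \near z0, 0 < dilation_slope F G a z.
  exact: (cvgr_gt _ (dilation_slope_continuous F G (sol_cont sol) (sol_grad_cont sol) a z0)).
exists e => // z m z2 s0 m1 zin mzin.
have m0 : 0 < m by exact: lt_trans m1.
apply: (cyl_power_lt a) => //; last 2 first.
- by rewrite z2.
- apply: (cyl_dilation_le_near F G (sol_cont sol) (sol_grad_cont sol) (sol_grad sol) a m e z0) => //.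
    by move=> y hy; exact: ltW (he _ hy).
  exact: ltW.
by rewrite sqnZ ltr_pMl // exprn_egt1 // ltW.
Qed.

Lemma cyl_decay_from (rho : R) : 0 < rho -> exists2 eps, 0 < eps &
  forall y, rho <= sqn y -> 0 <= y.2 -> eps * sqn y `^ (- b) <= U y.
Proof.
move=> r0.
have [eps e0 he] := cyl_decay F G H K p q c b sol kb K0 b0 p_ge c0.
have [m m0 hm] := cyl_min_annulus F G H K p q c b sol rho 1 r0.
have w0 : 0 < m * rho `^ b by rewrite mulr_gt0 ?powR_gt0.
exists (Num.min eps (m * rho `^ b)); first by rewrite lt_min e0.
move=> y ry y2; have s0 : 0 < sqn y by exact: lt_le_trans ry.
case: (leP 1 (sqn y)) => y1.
  apply: le_trans (he y y1 y2); rewrite ler_pM2r ?powR_gt0 //.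
  by rewrite ge_min lexx.
apply: le_trans (hm y ry (ltW y1) y2).
apply: (@le_trans _ _ (m * rho `^ b * sqn y `^ (- b))).
  by rewrite ler_pM2r ?powR_gt0 // ge_min lexx orbT.
rewrite powRN ler_pdivrMr ?powR_gt0 // ler_pM2l //.
by apply: ge0_ler_powR; rewrite ?nnegrE ?(ltW r0) ?(ltW s0) ?(ltW b0).
Qed.

(** Insert the decay bound at the inverse, the upper bound of [F] at [z], and
    [sqn (inversion L z) = L ^+ 2 / sqn z]. The resulting necessary condition fails as [z] tends to
    the centre with [L] fixed, because [b < beta], and also as [L] tends to [0] with [sqn z < L],
    because [b > 0]. *)
Lemma far_unordered (rho : R) : 0 < rho -> exists eps C, [/\ 0 < eps, 0 < C &
  forall L z, 0 < L -> z.2 = 0 -> 0 < sqn z -> sqn z <= 1 ->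
    rho <= sqn (inversion L z) -> ~ (cyl F beta z < cyl F beta (inversion L z)) ->
    eps * L `^ (2 * (beta - b - b)) <= C * sqn z `^ (2 * (beta - b))].
Proof.
move=> r0; have [eps e0 he] := cyl_decay_from rho r0.
have [C C0 hC] := bounded_on_ball F G H K p q c sol 1.
exists eps, C; split => // L z L0 z2 s0 s1 ry /negP; rewrite -leNgt.
set y := inversion L z in ry *.
have y0 : 0 < sqn y by exact: lt_le_trans ry.
have y2 : 0 <= y.2.
  by have := pcoordZ None (L / sqn z) z; rewrite [pcoord _ z]/= z2 mulr0 /= => ->.
rewrite (cyl_power b beta y y0) => h1.
have h2 : eps * sqn y `^ (beta - b - b) <= C * sqn z `^ beta.
  apply: (@le_trans _ _ (sqn y `^ (beta - b) * U y)).
    rewrite powRD ?(gt_eqF y0) ?implybT //.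
    by rewrite mulrCA ler_pM2l ?powR_gt0 //; exact: he.
  apply: le_trans h1 _; rewrite /cyl mulrC ler_pM2r ?powR_gt0 //; exact: hC.
have yE : sqn y `^ (beta - b - b) =
    L `^ (2 * (beta - b - b)) * sqn z `^ (- (beta - b - b)).
  rewrite sqn_inversion // powRM ?sqr_ge0 ?invr_ge0 ?ltW //.
  rewrite -powR_mulrn ?ltW // -powRrM; congr (_ * _).
  by rewrite -powR_inv1 ?ltW // -powRrM mulN1r.
move: h2; rewrite yE powRN mulrA ler_pdivrMr ?powR_gt0 // => h2.
apply: (le_trans h2); rewrite -mulrA ler_pM2l // -powRD ?(gt_eqF s0) ?implybT //.
by rewrite (_ : beta + (beta - b - b) = 2 * (beta - b)) //; ring.
Qed.

Lemma inversion_cvg (L0 : R) z0 : 0 < sqn z0 ->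
  inversion t.2 t.1 @[t --> filter_prod (nbhs z0) (nbhs L0)] --> inversion L0 z0.
Proof.
move=> s0; apply: cvg_pt => d; rewrite pcoordZ.
rewrite (_ : (fun t => _) = fun t : X * R => t.2 / sqn t.1 * pcoord d t.1); last first.
  by apply/funext => t; rewrite pcoordZ.
have fc : fst t @[t --> filter_prod (nbhs z0) (nbhs L0)] --> z0 by exact: cvg_fst.
have sc : snd t @[t --> filter_prod (nbhs z0) (nbhs L0)] --> L0 by exact: cvg_snd.
apply: cvgM; last exact: (cvg_comp _ _ fc (@pcoord_continuous _ _ d z0)).
apply: cvgM; first exact: sc.
apply: cvgV; first by rewrite gt_eqF.
exact: (cvg_comp _ _ fc (@sqn_continuous _ _ z0)).
Qed.

End MovingSpheres.

Lemma powR_small {R : realType} (a w : R) : 0 < a -> 0 < w ->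
  exists2 dlt, 0 < dlt & forall x, 0 <= x -> x < dlt -> x `^ a < w.
Proof.
move=> a0 w0; exists (w `^ a^-1); first by rewrite powR_gt0.
move=> x x0 xw; have -> : w = (w `^ a^-1) `^ a.
  by rewrite -powRrM mulVf ?lt0r_neq0 // powRr1 // ltW.
by apply: gt0_ltr_powR; rewrite ?nnegrE ?powR_ge0.
Qed.

(** * Increasing the radius *)

Section Continuation.
Context {R : realType} {k : nat}.
Local Notation X := ('rV[R]_k * R)%type.
Local Notation D := (option 'I_k).
Implicit Types (y z : X) (d e : D).
Variables (F : X -> R) (G : D -> X -> R) (H : D -> D -> X -> R).
Variables (K p q c b : R).
Hypothesis sol : halfspace_solution K p q c F G H.
Hypothesis kb : k%:R = 4 * b + 1.
Hypotheses (K0 : 0 < K) (b0 : 0 < b) (p_ge : b + 1 <= b * p) (c0 : 0 < c).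
Hypotheses (q_ge1 : 1 <= q) (q_lt : b * q < b + 2^-1).
Local Notation U := (cyl F b).

Let beta : R := (b + 2^-1) / q.

Let b_lt_beta : b < beta.
Proof. by rewrite /beta ltr_pdivlMr //; exact: lt_le_trans q_ge1. Qed.

Let far := far_unordered F G H K p q c b sol kb K0 b0 p_ge c0.

Let ball_near z0 (r : R) : 0 < r ->
  \forall z \near z0, forall d, `|pcoord d z0 - pcoord d z| < r.
Proof. by move=> r0; apply/nbhs_pt; exists r. Qed.

Let sqn_near (z0 : X) (r : R) : sqn z0 < r -> \forall z \near z0, sqn z < r.
Proof. by move=> h; exact: (cvgr_lt _ (@sqn_continuous _ _ z0) _ h). Qed.

Let sqn_near_gt (z0 : X) (r : R) : r < sqn z0 -> \forall z \near z0, r < sqn z.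
Proof. by move=> h; exact: (cvgr_gt _ (@sqn_continuous _ _ z0) _ h). Qed.

Let sphere_ordered_near_snd (L0 : R) z0 : z0.2 != 0 ->
  \forall z \near z0 & L \near L0, sphere_ordered F q b L z.
Proof.
move=> z2; exists ([set z | z.2 != 0], setT) => /=; last by move=> [z L] /= [/eqP h _] _ /h.
split; last exact: filterT.
apply/nbhs_pt; exists `|z0.2|; first by rewrite normr_gt0.
move=> z /(_ None) /= h; apply/eqP => zz; move: h.
by rewrite zz subr0 ltxx.
Qed.

(** The start. If the inverse is also near the centre, the slope [2 * b * F 0 > 0] decides;
    otherwise [far_unordered] and [sqn z < L] would force [eps <= C * L ^ (2 * b)], which fails for
    small [L]. *)
Lemma sphere_ordered_near00 :
  \forall z \near (0 : X) & L \near (0 : R), sphere_ordered F q b L z.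
Proof.
have W0 : 0 < dilation_slope F G b (0 : X).
  rewrite /dilation_slope big1 ?addr0; last by move=> d _; rewrite pcoord0 mulr0.
  by rewrite !mulr_gt0 // (sol_pos sol) /=.
have [e e0 he] := local_ordering F G H K p q c b sol b 0 b_lt_beta W0.
have [eps [C [ep0 C0 hf]]] := far (e ^+ 2) (exprn_gt0 2 e0).
have [dlt d0 hd] := @powR_small _ (2 * b) (eps / C) (mulr_gt0 (ltr0Sn R 1) b0) (divr_gt0 ep0 C0).
exists ([set z | (forall d, `|pcoord d (0 : X) - pcoord d z| < e) /\ sqn z < 1],
        [set L | L < dlt]) => /=.
  split; first apply: filterI; first exact: ball_near.
    by apply: sqn_near; rewrite (_ : sqn 0 = 0) //; apply/eqP; rewrite sqn_eq0.
  exact: lt_nbhsl.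
move=> [z L] /= [[ze z1] Ld] L0 z2 s0 zL.
have m1 : 1 < L / sqn z by rewrite ltr_pdivlMr // mul1r.
case: (pselect (forall d, `|pcoord d (0 : X) - pcoord d (inversion L z)| < e)) => [ye|/existsNP[d]].
  exact: he.
move=> /negP; rewrite -leNgt pcoord0 sub0r normrN => dy.
case: (pselect (cyl F beta z < cyl F beta (inversion L z))) => // nlt; exfalso.
have ry : e ^+ 2 <= sqn (inversion L z).
  apply: le_trans (le_sqr_sqn d _); rewrite -[leRHS]real_normK ?num_real //.
  by rewrite ler_pXn2r ?nnegrE // ltW.
have := hf L z L0 z2 s0 (ltW z1) ry nlt; apply/negP; rewrite -ltNge.
apply: (@le_lt_trans _ _ (C * L `^ (2 * (beta - b)))).
  rewrite ler_pM2l //; apply: ge0_ler_powR; rewrite ?nnegrE ?(ltW s0) ?(ltW L0) ?(ltW zL) //.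
  by rewrite mulr_ge0 // subr_ge0 ltW.
rewrite (_ : 2 * (beta - b) = 2 * (beta - b - b) + 2 * b); last by ring.
rewrite powRD ?(gt_eqF L0) ?implybT // mulrCA [ltRHS]mulrC ltr_pM2l ?powR_gt0 //.
by rewrite mulrC -ltr_pdivlMr // hd // ltW.
Qed.

(** Points near the centre have their inverses far away, uniformly for [L] near [L0 > 0]; this is
    where decay at infinity is needed. *)
Lemma sphere_ordered_near0 (L0 : R) : 0 < L0 ->
  \forall z \near (0 : X) & L \near L0, sphere_ordered F q b L z.
Proof.
move=> L00.
have [eps [C [ep0 C0 hf]]] := far 1 ltr01.
(* The exponent may have either sign, so the lower bound for this power of [L] near [L0] comes from
   continuity, not monotonicity. *)
pose w := L0 `^ (2 * (beta - b - b)) / 2.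
have w0 : 0 < w by rewrite divr_gt0 ?powR_gt0.
have g0 : 0 < 2 * (beta - b) by rewrite mulr_gt0 ?subr_gt0.
have [dlt d0 hd] := @powR_small _ _ (eps * w / C) g0 (divr_gt0 (mulr_gt0 ep0 w0) C0).
have h0 : sqn (0 : X) = 0 by apply/eqP; rewrite sqn_eq0.
have L2 : 0 < (L0 / 2) ^+ 2 by rewrite exprn_gt0 // divr_gt0.
exists ([set z | [/\ sqn z < 1, sqn z < (L0 / 2) ^+ 2 & sqn z < dlt]],
        [set L | L0 / 2 < L /\ w < L `^ (2 * (beta - b - b))]) => /=.
  split.
    near=> z; split; near: z; by apply: sqn_near; rewrite h0.
  near=> L; split; near: L.
    by apply: lt_nbhsr; rewrite ltr_pdivrMr // ltr_pMr // ltr1n.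
  apply: (cvgr_gt _ (powR_continuous _ _ L00)).
  by rewrite /w ltr_pdivrMr // ltr_pMr ?powR_gt0 // ltr1n.
move=> [z L] /= [[z1 zL2 zd] [L2L wL]] L_gt0 z2 s0 zL.
case: (pselect (cyl F beta z < cyl F beta (inversion L z))) => // nlt; exfalso.
have ry : 1 <= sqn (inversion L z).
  rewrite sqn_inversion // ler_pdivlMr // mul1r; apply: le_trans (ltW zL2) _.
  by rewrite ler_pXn2r ?nnegrE ?ltW // divr_gt0.
have := hf L z L_gt0 z2 s0 (ltW z1) ry nlt; apply/negP; rewrite -ltNge.
apply: (@lt_trans _ _ (eps * w)); last by rewrite ltr_pM2l.
by rewrite mulrC -ltr_pdivlMr // hd // ltW.
Unshelve. all: by end_near. Qed.

Lemma sphere_ordered_near_out (L0 : R) z0 : L0 < sqn z0 ->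
  \forall z \near z0 & L \near L0, sphere_ordered F q b L z.
Proof.
move=> Lz; pose M := (L0 + sqn z0) / 2.
have M1 : L0 < M by rewrite midf_lt.
have M2 : M < sqn z0 by rewrite midf_lt.
exists ([set z | M < sqn z], [set L | L < M]) => /=.
  by split; [exact: sqn_near_gt | exact: lt_nbhsl].
move=> [z L] /= [Mz LM] _ _ _ zL.
by have := lt_trans (lt_trans zL LM) Mz; rewrite ltxx.
Qed.

(** The gap at [L0] gives the weak order for the weight [b], hence the strict one for [beta], which
    is an open condition in [z] and [L] jointly. *)
Lemma sphere_ordered_near_in (L0 : R) z0 : 0 < L0 -> 0 < sqn z0 -> sqn z0 < L0 ->
  (0 <= (inversion L0 z0).2 -> 0 <= inversion_gap F b L0 (inversion L0 z0)) ->
  \forall z \near z0 & L \near L0, sphere_ordered F q b L z.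
Proof.
move=> L00 s0 zL gap.
have [z2|z2] := eqVneq z0.2 0; last exact: sphere_ordered_near_snd.
  have y2 : (inversion L0 z0).2 = 0.
    by have := pcoordZ None (L0 / sqn z0) z0; rewrite [pcoord _ z0]/= z2 mulr0.
  have lt1 : cyl F beta z0 < cyl F beta (inversion L0 z0).
    apply: (cyl_power_lt F G H K p q c sol b) => //; last 2 first.
    - by rewrite z2.
    - by move: gap; rewrite y2 lexx /inversion_gap inversionK // subr_ge0; exact.
    rewrite sqn_inversion // ltr_pdivlMr // expr2 ltr_pM ?ltW //.
  have s'0 := sqn_inversion_gt0 L0 z0 L00 s0.
  have cv : cyl F beta (inversion t.2 t.1) - cyl F beta t.1
      @[t --> filter_prod (nbhs z0) (nbhs L0)] -->
      cyl F beta (inversion L0 z0) - cyl F beta z0.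
    apply: cvgB.
      exact: (cvg_comp _ _ (inversion_cvg L0 z0 s0) (gt0_cyl_continuous F (sol_cont sol) beta _ s'0)).
    have fc : fst t @[t --> filter_prod (nbhs z0) (nbhs L0)] --> z0 by exact: cvg_fst.
    exact: (cvg_comp _ _ fc (gt0_cyl_continuous F (sol_cont sol) beta _ s0)).
  have pos : 0 < cyl F beta (inversion L0 z0) - cyl F beta z0 by rewrite subr_gt0.
  have [[A B] AB sub] := cvgr_gt _ cv _ pos.
  exists (A, B) => // -[z L] /sub /= h _ _ _ _.
  by rewrite -subr_gt0.
Qed.

(** For [y] on the sphere and [L = expR (- s) * L0], the inverse of [y] is [expR (- s) *: y], so the
    gaps of the smaller spheres say that [cyl F b] is no larger just inside than at [y]. This is
    differentiated at interior points of the sphere and carried to the boundary along [tilt]. *)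
Lemma sphere_slope_ge0 (L0 : R) z0 : 0 < L0 -> z0.2 = 0 -> sqn z0 = L0 ->
  (forall L, 0 < L -> L <= L0 -> forall y, L <= sqn y -> 0 <= y.2 -> 0 <= inversion_gap F b L y) ->
  0 <= dilation_slope F G b z0.
Proof.
move=> L00 z2 zL gap.
have int y : 0 < y.2 -> sqn y = L0 -> 0 <= dilation_slope F G b y.
  move=> y2 yL; rewrite leNgt; apply/negP => neg.
  have n0 : 0 < sqn y `^ b by rewrite powR_gt0 // yL.
  have dU := der_cyl_dilation F G (sol_grad_cont sol) (sol_grad sol) b 0 y y2.
  rewrite mulr0 expR0 mulr1 scale1r in dU.
  set S := _ * dilation_slope _ _ _ _ in dU.
  have S0 : S < 0 by rewrite /S pmulr_rlt0.
  have e0 : 0 < - S / 2 by rewrite divr_gt0 // oppr_gt0.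
  have /is_derive_eps /(_ _ e0) := dU.
  rewrite expR0 scale1r => /nbhs_ballP[r /= r0 hr].
  have r2 : 0 < r / 2 by rewrite divr_gt0.
  have := hr (- (r / 2)); rewrite /ball /= sub0r opprK gtr0_norm //.
  rewrite ltr_pdivrMr // ltr_pMr // ltr1n => /(_ isT).
  rewrite subr0 normrN (gtr0_norm r2) ler_norml => /andP[h _].
  have Lr0 : 0 < expR (- (r / 2)) * L0 by rewrite mulr_gt0 ?expR_gt0.
  have Lr : expR (- (r / 2)) * L0 <= L0.
    apply: ler_piMl; first exact: ltW.
    by rewrite -[leRHS]expR0 ler_expR oppr_le0 ltW.
  have := gap _ Lr0 Lr y; rewrite yL => /(_ Lr (ltW y2)).
  rewrite /inversion_gap /inversion yL mulfK ?gt_eqF //.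
  rewrite subr_ge0 => h1.
  have : 0 < - S / 2 * (r / 2) by rewrite mulr_gt0.
  move: h h1; move: (cyl F b y) (cyl F b _) (r / 2) (S) => u1 u2 u3 u4 h h1.
  rewrite mulrN in h; lra.
have h2 : (sqn z0 `^ 2^-1) ^+ 2 = sqn z0.
  by rewrite -powR_mulrn ?powR_ge0 // -powRrM mulVf ?powRr1 // zL ltW.
have h0 : 0 < sqn z0 `^ 2^-1 by rewrite powR_gt0 // zL.
rewrite leNgt; apply/negP => neg.
have := cvg_comp _ _ (tilt_cvg0 (sqn z0 `^ 2^-1) z0 z2)
  (dilation_slope_continuous F G (sol_cont sol) (sol_grad_cont sol) b z0).
move=> /cvgr_lt /(_ _ neg) /nbhs_ballP[r /= r0 hr].
pose t := Num.min (r / 2) 1.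
have t0 : 0 < t by rewrite lt_min divr_gt0 //=.
have tr : t < r.
  apply: (@le_lt_trans _ _ (r / 2)); first by rewrite ge_min lexx.
  by rewrite ltr_pdivrMr // ltr_pMr // ltr1n.
have t1 : t < 2.
  by apply: (@le_lt_trans _ _ 1); [rewrite ge_min lexx orbT | rewrite ltr1n].
have := hr t; rewrite /ball /= sub0r normrN gtr0_norm // => /(_ tr).
rewrite ltNge => /negP; apply; apply: int.
  by rewrite /= mulr_gt0 // sin2_gt0 // t0.
by rewrite sqn_tilt.
Qed.

Lemma sphere_ordered_near_on (L0 : R) z0 : 0 < L0 -> sqn z0 = L0 ->
  (forall L, 0 < L -> L <= L0 -> forall y, L <= sqn y -> 0 <= y.2 -> 0 <= inversion_gap F b L y) ->
  \forall z \near z0 & L \near L0, sphere_ordered F q b L z.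
Proof.
move=> L00 zL gap; have s0 : 0 < sqn z0 by rewrite zL.
have [z2|z2] := eqVneq z0.2 0; last exact: sphere_ordered_near_snd.
  have W0 := sphere_slope_ge0 L0 z0 L00 z2 zL gap.
  (* An intermediate weight: [b < a] turns the nonnegative slope into a positive one, and [a < beta]
     leaves room for the strict ordering. *)
  pose a := (b + beta) / 2.
  have ab : b < a by rewrite midf_lt.
  have abeta : a < beta by rewrite midf_lt.
  have Wa : 0 < dilation_slope F G a z0.
    rewrite (_ : dilation_slope F G a z0 = dilation_slope F G b z0 + 2 * (a - b) * F z0).
      by rewrite ltr_wpDl // !mulr_gt0 ?subr_gt0 // (sol_pos sol) // z2.
    by rewrite /dilation_slope; ring.
  have [e e0 he] := local_ordering F G H K p q c b sol a z0 abeta Wa.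
  have invz : inversion L0 z0 = z0 by rewrite /inversion zL divff ?gt_eqF // scale1r.
  have := inversion_cvg L0 z0 s0; rewrite invz => /(_ _ (ball_near z0 e e0)) h1.
  have [[A B] /= [An Bn] sub] := h1.
  exists (A `&` [set z | forall d, `|pcoord d z0 - pcoord d z| < e], B) => /=.
    by split => //; apply: filterI => //; exact: ball_near.
  move=> [z L] /= [[Az g2] BL] Lp zz sz zltL.
  have g1 := sub (z, L) (conj Az BL).
  by apply: he => //; rewrite ltr_pdivlMr // mul1r.
Qed.

(** Local orderings are made uniform by compactness of a ball; points outside it are outside all
    spheres with [L] near [L0]. For [L0 = 0] the assumption on gaps is vacuous, so the start of the
    method is included. *)
Lemma sphere_ordered_near (L0 : R) : 0 <= L0 ->
  (forall L, 0 < L -> L <= L0 -> forall y, L <= sqn y -> 0 <= y.2 -> 0 <= inversion_gap F b L y) ->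
  \forall L \near L0, forall z, sphere_ordered F q b L z.
Proof.
move=> L00 gap.
have cc := (compact_near_coveringP _).1 (@compact_sqn_le R k (L0 + 1)).
have near1 : \forall L \near L0, [set z | sqn z <= L0 + 1] `<=` (fun z => sphere_ordered F q b L z).
  apply: (cc R (nbhs L0) (fun L z => sphere_ordered F q b L z)) => z0 _.
  case: (ltgtP (sqn z0) L0) => zL.
  - have L_gt0 : 0 < L0 by apply: le_lt_trans zL; exact: sqn_ge0.
    have [s0|] := ltP 0 (sqn z0).
      apply: sphere_ordered_near_in => // y2; apply: gap => //.
      by rewrite sqn_inversion // ler_pdivlMr // expr2 ler_pM2l // ltW.
    move=> sz; have /eqP : sqn z0 == 0 by rewrite eq_le sz sqn_ge0.
    by move/eqP; rewrite sqn_eq0 => /eqP ->; exact: sphere_ordered_near0.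
  - exact: sphere_ordered_near_out.
  - have [L_gt0|] := ltP 0 L0; first exact: sphere_ordered_near_on.
    move=> Ln; have L0E : L0 = 0 by apply/eqP; rewrite eq_le Ln L00.
    move: zL; rewrite L0E => /eqP; rewrite sqn_eq0 => /eqP ->.
    exact: sphere_ordered_near00.
near=> L => z; case: (leP (sqn z) (L0 + 1)) => zL.
  by have := near near1 L; apply.
move=> _ _ _ h; exfalso.
have : L < L0 + 1 by near: L; apply: lt_nbhsl; rewrite ltrDl.
by move=> h1; have := lt_trans (lt_trans zL h) h1; rewrite ltxx.
Unshelve. all: by end_near. Qed.

(** Take the infimum [L0] of the bad values. All gaps up to [L0] are nonnegative, so the ordering
    holds for all [L] near [L0], and no bad value can be close to [L0]. *)
Lemma inversion_gap_ge0 (L : R) y : 0 < L -> L <= sqn y -> 0 <= y.2 ->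
  0 <= inversion_gap F b L y.
Proof.
move=> L_gt0 Ly y2; rewrite leNgt; apply/negP => neg.
pose S := [set L : R | 0 < L /\ exists y, [/\ L <= sqn y, 0 <= y.2 & inversion_gap F b L y < 0]].
have SL : S L by split => //; exists y.
have lbS : lbound S 0 by move=> l [l0 _]; exact: ltW.
have hi : has_inf S by split; [exists L | exists 0].
pose L0 := inf S.
have L00 : 0 <= L0 by apply: lb_le_inf => //; exists L.
have below l : 0 < l -> l < L0 -> forall y, l <= sqn y -> 0 <= y.2 -> 0 <= inversion_gap F b l y.
  move=> l0 lL z lz z2; rewrite leNgt; apply/negP => n.
  have Sl : S l by split => //; exists z.
  have : L0 <= l by apply: ge_inf => //; exists 0.
  by rewrite leNgt lL.
(* The infimum itself is good: at a fixed [z] its gap is a limit of gaps of smaller spheres. *)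
have upto l : 0 < l -> l <= L0 -> forall y, l <= sqn y -> 0 <= y.2 -> 0 <= inversion_gap F b l y.
  move=> l0; rewrite le_eqVlt => /predU1P[lL|]; last exact: below.
  move=> z lz z2; rewrite leNgt; apply/negP => n.
  have s0 : 0 < sqn z by exact: lt_le_trans lz.
  have ic : inversion t z @[t --> l] --> inversion l z.
    apply: cvg_pt => d; rewrite pcoordZ.
    rewrite (_ : (fun t => _) = fun t => t / sqn z * pcoord d z); last first.
      by apply/funext => t; rewrite pcoordZ.
    apply: cvgM; last exact: cvg_cst.
    by apply: cvgM; [exact: cvg_id | exact: cvg_cst].
  have gc : inversion_gap F b t z @[t --> l] --> inversion_gap F b l z.
    apply: cvgB; first exact: cvg_cst.
    exact: (cvg_comp _ _ ic (gt0_cyl_continuous F (sol_cont sol) b _ (sqn_inversion_gt0 l z l0 s0))).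
  have : \forall t \near l, inversion_gap F b t z < 0 by exact: (cvgr_lt _ gc _ n).
  move=> /nbhs_ballP[r /= r0 hr].
  pose t := l - Num.min (r / 2) (l / 2).
  have m0 : 0 < Num.min (r / 2) (l / 2) by rewrite lt_min !divr_gt0.
  have mr : Num.min (r / 2) (l / 2) < r.
    apply: (@le_lt_trans _ _ (r / 2)); first by rewrite ge_min lexx.
    by rewrite ltr_pdivrMr // ltr_pMr // ltr1n.
  have ml : Num.min (r / 2) (l / 2) < l.
    apply: (@le_lt_trans _ _ (l / 2)); first by rewrite ge_min lexx orbT.
    by rewrite ltr_pdivrMr // ltr_pMr // ltr1n.
  have := hr t; rewrite /ball /= /t opprB addrC subrK gtr0_norm // => /(_ mr).
  rewrite ltNge => /negP; apply; apply: below => //.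
  - by rewrite subr_gt0.
  - by rewrite -lL ltrBlDr ltrDl.
  - by apply: le_trans lz; rewrite lerBlDr lerDl ltW.
have /nbhs_ballP[r /= r0 hr] := sphere_ordered_near L0 L00 upto.
have [l Sl lr] := inf_adherent r0 hi.
have L0l : L0 <= l by apply: ge_inf => //; exists 0.
have lin : forall z, sphere_ordered F q b l z.
  apply: hr; rewrite /ball /= distrC ger0_norm ?subr_ge0 //.
  by rewrite ltrBlDl.
case: Sl => l0 [z [lz z2]]; rewrite ltNge => /negP; apply.
exact: (sphere_ordered_gap F G H K p q c b sol kb K0 b0 p_ge c0 q_ge1 l l0 lin).
Qed.

Lemma cyl_radially_nondecreasing (m : R) y : 1 <= m -> 0 < sqn y -> 0 <= y.2 ->
  U y <= U (m *: y).
Proof.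
move=> m1 s0 y2; have m0 : 0 < m by exact: lt_le_trans m1.
(* This sphere exchanges [y] and [m *: y]. *)
have := inversion_gap_ge0 (m * sqn y) (m *: y) (mulr_gt0 m0 s0).
rewrite sqnZ expr2 -mulrA ler_pM2l // ler_pMl // => /(_ m1).
have : 0 <= (m *: y).2 by have := pcoordZ None m y; rewrite /= => ->; rewrite mulr_ge0 // ltW.
move=> h /(_ h); rewrite /inversion_gap /inversion sqnZ scalerA.
rewrite (_ : m * sqn y / (m ^+ 2 * sqn y) * m = 1) ?scale1r ?subr_ge0 //.
by field; rewrite !lt0r_neq0.
Qed.

End Continuation.

(** * Positivity on the boundary *)

Section BoundaryPositivity.
Context {R : realType} {k : nat}.
Local Notation X := ('rV[R]_k * R)%type.
Local Notation D := (option 'I_k).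
Implicit Types (y z : X) (d e : D).
Variables (F : X -> R) (G : D -> X -> R) (H : D -> D -> X -> R) (K p : R).
Hypotheses (Fc : continuous F) (Gc : forall d, continuous (G d)).
Hypotheses (FG : has_grad F G) (GH : forall d, has_grad (G d) (H d)).
Hypothesis pde : forall y, 0 < y.2 -> \sum_d H d d y = K * F y `^ p.
Hypotheses (Fpos : forall y, 0 < y.2 -> 0 < F y) (K0 : 0 < K) (p1 : 1 <= p).

Lemma d2_quad (A B C : R) : has_d2 (fun s => A + B * s + C * s ^+ 2) B (2 * C).
Proof.
exists (fun s => B + 2 * C * s); split.
- near=> s.
  rewrite (_ : (fun s => _) = fun s => A + B * s + C * (s * s)); last first.
    by apply/funext => t; rewrite expr2.
  apply: der_eq (derD (derD (derC s A) (derZ B (der_id s)))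
    (derZ C (derM (der_id s) (der_id s)))) _.
  by ring.
- by rewrite mulr0 addr0.
- apply: der_eq (derD (derC 0 B) (derZ (2 * C) (der_id 0))) _.
  by ring.
Unshelve. all: by end_near. Qed.

(* [t + N t ^ 2 - |x'| ^ 2], with [N] the dimension. *)
Definition hopf_barrier (eps : R) y : R :=
  eps * (y.2 + (#|{: D}|%:R + 1) * y.2 ^+ 2 - sqn y).

Lemma sqn_line y d (s : R) :
  sqn (y + s *: dirv d) = sqn y + 2 * pcoord d y * s + s ^+ 2.
Proof.
rewrite /sqn (bigD1 d) //= [in RHS](bigD1 d) //=.
rewrite pcoordD pcoordZ pcoord_dirv eqxx mulr1.
have -> : \sum_(e | e != d) pcoord e (y + s *: dirv d) ^+ 2 = \sum_(e | e != d) pcoord e y ^+ 2.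
  apply: eq_bigr => e ed.
  by rewrite pcoordD pcoordZ pcoord_dirv (negbTE ed) mulr0 addr0.
by ring.
Qed.

Lemma snd_line y d (s : R) : (y + s *: dirv d).2 = y.2 + s * (None == d)%:R.
Proof. by have := pcoordD None y (s *: dirv d); rewrite pcoordZ pcoord_dirv. Qed.

Lemma line_cvg0 y d : y + s *: dirv d @[s --> (0 : R)] --> y.
Proof.
suff dl : forall e, is_derive (0 : R) 1 (fun s => pcoord e (y + s *: dirv d)) (e == d)%:R.
  by have := curve_cvg _ _ _ dl; rewrite scale0r addr0.
move=> e.
rewrite (_ : (fun s => _) = fun s => pcoord e y + s * (e == d)%:R); last first.
  by apply/funext => s; rewrite pcoordD pcoordZ pcoord_dirv.
by apply: der_eq (derD (derC 0 _) (derM (der_id 0) (derC 0 _))) _; ring.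
Qed.

Lemma snd_near y : 0 < y.2 -> \forall z \near y, 0 < z.2.
Proof. by move=> y2; exact: (cvgr_gt _ (@pcoord_continuous _ _ None y) _ y2). Qed.

Lemma d2_line y d : 0 < y.2 ->
  has_d2 (fun s => F (y + s *: dirv d)) (G d y) (H d d y).
Proof.
move=> y2; exists (fun s => G d (y + s *: dirv d)); split.
- near=> s; apply: has_grad_line => //; near: s.
  exact: line_cvg0 y d _ (snd_near y y2).
- by rewrite scale0r addr0.
- exact: GH.
Unshelve. all: by end_near. Qed.

Lemma d2_hopf_barrier eps y d :
  exists b1, has_d2 (fun s => hopf_barrier eps (y + s *: dirv d)) b1
    (2 * eps * ((#|{: D}|%:R + 1) * (None == d)%:R - 1)).
Proof.
set n := #|{: D}|%:R + 1; set t := (None == d)%:R : R.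
have tt : t ^+ 2 = t by rewrite /t; case: eqP => _; rewrite ?expr1n ?expr0n.
exists (eps * (t + 2 * n * y.2 * t - 2 * pcoord d y)).
rewrite (_ : (fun s => _) = fun s => hopf_barrier eps y +
   (eps * (t + 2 * n * y.2 * t - 2 * pcoord d y)) * s + eps * (n * t - 1) * s ^+ 2).
  by apply: d2_eq (d2_quad _ _ _) _ _ => //; ring.
apply/funext => s; rewrite /hopf_barrier sqn_line snd_line -/n -/t.
rewrite -[X in _ = _ + _ * (n * X - 1) * _]tt; ring.
Qed.

Lemma hopf_barrier_laplacian (eps : R) :
  \sum_(d : D) 2 * eps * ((#|{: D}|%:R + 1) * (None == d)%:R - 1) = 2 * eps :> R.
Proof.
rewrite -mulr_sumr sumrB sumr_const -mulr_sumr.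
rewrite (bigD1 None) //= big1 ?addr0 ?mulr1 => [|d /negbTE]; last by rewrite eq_sym => ->.
by ring.
Qed.

(** Hopf's lemma for [F] itself, by comparison with [hopf_barrier] on a half-ball. On the flat side
    the barrier is nonpositive; on the low part of the round side it is negative; at height [tau]
    and above it is at most [m]; elsewhere its Laplacian [2 * eps] exceeds [K * F ^ p]. *)
Lemma hopf_bound : exists2 eps, 0 < eps & exists2 r, 0 < r &
  forall t, 0 < t -> t < r -> 0 <= F 0 -> (forall y, y.2 = 0 -> 0 <= F y) ->
  eps * t <= F (t *: dirv None).
Proof.
pose n : R := #|{: D}|%:R.
have n0 : 0 <= n by exact: ler0n.
have K_gt0 := K0; have p_ge1 := p1.
(* Where [F] lies below the barrier, [F <= eps * (n + 2) * r], so this choice gives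
   [K * F <= eps < 2 * eps]. *)
have [r [r0 r1 Kr]] : exists r, [/\ 0 < r, r <= 1 & K * ((n + 2) * r) <= 1].
  have w0 : 0 < K * (n + 2) by rewrite mulr_gt0 // ltr_wpDl.
  exists (Num.min 1 (K * (n + 2))^-1); rewrite lt_min ltr01 invr_gt0 w0 ge_min lexx; split => //.
  rewrite mulrA -ler_pdivlMl // mulr1.
  by rewrite ge_min lexx orbT.
(* Below this height the positive part of the barrier is less than [eps * r ^+ 2], its negative part
   on the round side. *)
pose tau := r ^+ 2 / (n + 2).
have tau0 : 0 < tau by rewrite divr_gt0 ?exprn_gt0 // ltr_wpDl.
pose A : set X := [set y | sqn y <= r ^+ 2] `&` [set y | 0 <= sqn y /\ 0 <= y.2].
have cA : compact A by apply: compact_closedI; [exact: compact_sqn_le | exact: closed_half_annulus].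
have [m m0 mF] : exists2 m, 0 < m & forall y, sqn y <= r ^+ 2 -> tau <= y.2 -> m <= F y.
  pose T : set X := [set y | sqn y <= r ^+ 2] `&` [set y | tau <= y.2].
  have cT : compact T.
    apply: compact_closedI; first exact: compact_sqn_le.
    apply: (@closed_comp _ _ (pcoord None) [set x : R | tau <= x]); last exact: closed_ge.
    by move=> y _; exact: pcoord_continuous.
  case: (pselect (T !=set0)) => [ne|e]; last by exists 1 => // y h1 h2; case: e; exists y.
  have [|y] := @compact_EVT_min _ _ F T ne cT; first by apply: continuous_subspaceT.
  rewrite inE => -[_ yt] ymin; exists (F y); first by apply: Fpos; exact: lt_le_trans yt.
  by move=> z h1 h2; apply: ymin; rewrite inE.
(* The bound by [m] handles heights above [tau]; the bound by [1] gives [F <= 1], hence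
   [F ^ p <= F], where [F] lies below the barrier. *)
pose eps := Num.min 1 m / (n + 2).
have n2 : 0 < n + 2 by rewrite ltr_wpDl.
have e0 : 0 < eps by rewrite divr_gt0 // lt_min ltr01.
have epsE : eps * (n + 2) = Num.min 1 m by rewrite /eps divfK // gt_eqF.
have eps1 : eps * (n + 2) <= 1 by rewrite epsE ge_min lexx.
have epsm : eps * (n + 2) <= m by rewrite epsE ge_min lexx orbT.
exists eps => //; exists r => // t t0 tr F0 Fb.
have h2 y : y.2 ^+ 2 <= sqn y by exact: (le_sqr_sqn None y).
have hub y : 0 <= y.2 -> y.2 <= 1 -> hopf_barrier eps y <= eps * ((n + 2) * y.2).
  move=> y0 y1; rewrite ler_pM2l // -/n.
  have i1 : y.2 ^+ 2 <= y.2 by rewrite expr2 ler_piMl.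
  have i2 : n * y.2 ^+ 2 <= n * y.2 by rewrite ler_wpM2l.
  by have := h2 y; rewrite mulrDl mul1r [(n + 2) * _]mulrDl; lra.
pose v y := F y - hopf_barrier eps y.
suff vA y : A y -> 0 <= v y.
  have At : A (t *: dirv None).
    have sE : sqn (t *: dirv None : X) = t ^+ 2.
      have := sqn_line 0 None t; rewrite add0r pcoord0 mulr0 mul0r addr0 => ->.
      by rewrite (_ : sqn 0 = 0) ?add0r //; apply/eqP; rewrite sqn_eq0.
    split => /=; first by rewrite sE ler_pXn2r ?nnegrE ?ltW.
    split; first by rewrite sE sqr_ge0.
    by have := pcoordZ None t (dirv None : X); rewrite pcoord_dirv eqxx mulr1 /= => ->; exact: ltW.
  have := vA _ At; rewrite /v /hopf_barrier.
  have -> : (t *: dirv None : X).2 = t.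
    by have := pcoordZ None t (dirv None : X); rewrite pcoord_dirv eqxx mulr1.
  have sE : sqn (t *: dirv None : X) = t ^+ 2.
    have := sqn_line 0 None t; rewrite add0r pcoord0 mulr0 mul0r addr0 => ->.
    by rewrite (_ : sqn 0 = 0) ?add0r //; apply/eqP; rewrite sqn_eq0.
  (* On the vertical axis the barrier is [eps * (t + n * t ^+ 2)]. *)
  rewrite sE -/n subr_ge0; apply: le_trans; rewrite ler_pM2l //.
  by rewrite -addrA lerDl mulrDl mul1r addrK mulr_ge0 // sqr_ge0.
move=> Ay; rewrite leNgt; apply/negP => neg.
have [|y1] := @compact_EVT_min _ _ v A (ex_intro _ y Ay) cA.
  apply: continuous_subspaceT => z; apply: cvgB; first exact: Fc.
  apply: cvgM; first exact: cvg_cst.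
  apply: cvgB; last exact: sqn_continuous.
  have sc : snd w @[w --> z] --> z.2 by exact: (@pcoord_continuous _ _ None z).
  apply: cvgD => //; apply: cvgM; first exact: cvg_cst.
  rewrite expr2 (_ : (fun w => _) = fun w : X => w.2 * w.2); first exact: cvgM.
  by apply/funext => w; rewrite expr2.
rewrite inE => -[s1 [_ t1]] ymin.
have neg1 : F y1 < hopf_barrier eps y1.
  by rewrite -subr_lt0; apply: le_lt_trans neg; apply: ymin; rewrite inE.
have y1r : y1.2 <= r.
  rewrite -(@ler_pXn2r _ 2) ?nnegrE ?(ltW r0) //; exact: le_trans (h2 y1) s1.
have hub1 := hub y1 t1 (le_trans y1r r1).
case: (ltgtP 0 y1.2) t1 => // t1 _; last first.
  have := Fb y1 (esym t1); move: neg1; rewrite /hopf_barrier -t1 expr0n /= mulr0 addr0 sub0r.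
  move=> g1 g2; have := le_lt_trans g2 g1; rewrite pmulr_rgt0 // oppr_gt0.
  by rewrite ltNge sqn_ge0.
have lt_tau : y1.2 < tau.
  rewrite ltNge; apply/negP => g; have := mF y1 s1 g; rewrite leNgt => /negP; apply.
  apply: lt_le_trans neg1 _; apply: le_trans hub1 _; apply: le_trans epsm.
  by rewrite ler_pM2l // ler_piMr ?(ltW n2) //; exact: le_trans r1.
have s1' : sqn y1 < r ^+ 2.
  rewrite lt_neqAle s1 andbT; apply/eqP => E.
  have := lt_trans (Fpos y1 t1) neg1; rewrite pmulr_rgt0 // E -/n.
  rewrite subr_gt0 => g1; move: lt_tau; rewrite /tau ltr_pdivlMr // => g2.
  have i1 : y1.2 ^+ 2 <= y1.2 by rewrite expr2 ler_piMl ?(ltW t1) // (le_trans y1r).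
  have i2 : n * y1.2 ^+ 2 <= n * y1.2 by rewrite ler_wpM2l.
  by move: g1 g2; rewrite mulrDl mul1r mulrDr; lra.
have ynear : \forall z \near y1, v y1 <= v z.
  near=> z; apply: ymin; rewrite inE; split => /=.
    by apply: ltW; near: z; exact: (cvgr_lt _ (@sqn_continuous _ _ y1) _ s1').
  by split; [exact: sqn_ge0 | apply: ltW; near: z; exact: snd_near].
have lapl : 2 * eps <= \sum_d H d d y1.
  rewrite -(hopf_barrier_laplacian eps); apply: ler_sum => d _.
  have [b1 dh] := d2_hopf_barrier eps y1 d.
  rewrite -subr_ge0; apply: d2_min (d2B (d2_line y1 d t1) dh) _.
  rewrite scale0r addr0; exact: (line_cvg0 y1 d _ ynear).
move: lapl; rewrite pde // leNgt => /negP; apply.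
have F1 : F y1 <= eps * ((n + 2) * r).
  apply: ltW; apply: lt_le_trans neg1 _; apply: le_trans hub1 _.
  by rewrite ler_pM2l // ler_pM2l.
have F2 : F y1 <= 1.
  apply: le_trans F1 _; apply: le_trans eps1; rewrite ler_pM2l //.
  by rewrite ler_piMr ?(ltW n2).
have F3 : F y1 `^ p <= F y1 by apply: ge1r_powR => //; rewrite Fpos.
apply: (@le_lt_trans _ _ (K * (eps * ((n + 2) * r)))).
  by rewrite ler_pM2l //; exact: le_trans F3 F1.
rewrite mulrCA [ltRHS]mulrC ltr_pM2l //; apply: le_lt_trans Kr _.
by rewrite ltr1n.
Unshelve. all: by end_near. Qed.

End BoundaryPositivity.

(** * Symmetry and the profile *)

Section Symmetry.
Context {R : realType} {k : nat}.
Local Notation X := ('rV[R]_k * R)%type.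
Local Notation D := (option 'I_k).
Implicit Types (y z v : X) (d e : D).

Lemma has_grad_translate (f : X -> R) (g : D -> X -> R) v : v.2 = 0 -> has_grad f g ->
  has_grad (fun y => f (y + v)) (fun d y => g d (y + v)).
Proof.
move=> v2 fg y y2 d.
have yv2 : 0 < (y + v).2 by rewrite /= v2 addr0.
have := fg _ yv2 d; congr is_derive; apply/funext => s.
by rewrite addrAC.
Qed.

Lemma continuous_translate (f : X -> R) v y : {for y + v, continuous f} ->
  {for y, continuous (fun y => f (y + v))}.
Proof.
move=> fc.
suff tc : z + v @[z --> y] --> y + v by exact: (cvg_comp _ _ tc fc).
apply: cvg_pt => d; rewrite pcoordD.
rewrite (_ : (fun z => _) = fun z => pcoord d z + pcoord d v); last first.
  by apply/funext => z; rewrite pcoordD.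
by apply: cvgD; [exact: pcoord_continuous | exact: cvg_cst].
Qed.

Variables (F : X -> R) (G : D -> X -> R) (H : D -> D -> X -> R) (K p q c b : R).

Lemma halfspace_solution_translate v : v.2 = 0 -> halfspace_solution K p q c F G H ->
  halfspace_solution K p q c (fun y => F (y + v)) (fun d y => G d (y + v))
    (fun d e y => H d e (y + v)).
Proof.
move=> v2 sol; have vE y : (y + v).2 = y.2 by rewrite /= v2 addr0.
split.
- by move=> y; exact: continuous_translate (sol_cont sol (y + v)).
- by move=> d y; exact: continuous_translate (sol_grad_cont sol d (y + v)).
- move=> d e y y2; have yv2 : 0 < (y + v).2 by rewrite vE.
  exact: continuous_translate (sol_hess_cont sol d e (y + v) yv2).
- exact: has_grad_translate v2 (sol_grad sol).
- by move=> d; exact: has_grad_translate v2 (sol_hess sol d).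
- by move=> y y2; apply: (sol_pde sol); rewrite vE.
- by move=> y y2; apply: (sol_bd sol); rewrite vE.
- by move=> y y2; apply: (sol_pos sol); rewrite vE.
Qed.

Hypothesis sol : halfspace_solution K p q c F G H.
Hypothesis kb : k%:R = 4 * b + 1.
Hypotheses (K0 : 0 < K) (b0 : 0 < b) (p_ge : b + 1 <= b * p) (c0 : 0 < c).
Hypotheses (q_ge1 : 1 <= q) (q_lt : b * q < b + 2^-1).

(* The ray from the boundary point [x1 - (x2 - x1) / s] through [(x1, t)] meets the line over
   [x2] at height [(1 + s) t]; let [s] tend to [0]. *)
Lemma horizontal_le (x1 x2 : 'rV[R]_k) (t : R) : 0 < t -> F (x1, t) <= F (x2, t).
Proof.
move=> t0; rewrite leNgt; apply/negP => neg.
have ray (s : R) : 0 < s -> F (x1, t) <= (1 + s) `^ (2 * b) * F (x2, (1 + s) * t).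
  move=> s0; pose v : X := (x1 - s^-1 *: (x2 - x1), 0).
  pose y : X := (s^-1 *: (x2 - x1), t).
  have y2 : 0 < y.2 by [].
  have s1 : 0 < sqn y := pos_sqn_gt0 y y2.
  have solv := halfspace_solution_translate v erefl sol.
  have m1 : 1 <= 1 + s by rewrite lerDl ltW.
  have m0 : 0 < 1 + s by exact: lt_le_trans m1.
  have := cyl_radially_nondecreasing _ _ _ K p q c b solv kb K0 b0 p_ge c0 q_ge1 q_lt
    (1 + s) y m1 s1 (ltW y2).
  rewrite /cyl sqnZ powRM ?sqn_ge0 ?sqr_ge0 // [_ `^ b * sqn y `^ b]mulrC -mulrA.
  rewrite ler_pM2l ?powR_gt0 // -powR_mulrn ?(ltW m0) // -powRrM.
  have -> : y + v = (x1, t).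
    by rewrite /y /v; congr (_, _); rewrite /= ?addr0 // addrC subrK.
  have -> : (1 + s) *: y + v = (x2, (1 + s) * t) => //.
  rewrite /y /v; congr (_, _); rewrite /= ?addr0 //.
  by apply/rowP => i; rewrite !mxE; field; rewrite gt_eqF.
have cv : (1 + s) `^ (2 * b) * F (x2, (1 + s) * t) @[s --> (0 : R)] --> F (x2, t).
  have sc : 1 + s @[s --> (0 : R)] --> (1 : R).
    by rewrite -[X in _ --> X]addr0; apply: cvgD; [exact: cvg_cst | exact: cvg_id].
  rewrite -[X in _ --> X]mul1r; apply: cvgM.
    have := cvg_comp _ _ sc (powR_continuous (2 * b) 1 ltr01).
    by rewrite powR1.
  suff tc : (x2, (1 + s) * t) @[s --> (0 : R)] --> (x2, t).
    exact: (cvg_comp _ _ tc (sol_cont sol (x2, t))).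
  apply: cvg_pt => -[i|] /=; first exact: cvg_cst.
  rewrite -[X in _ --> X]mul1r; apply: cvgM => //; exact: cvg_cst.
have /nbhs_ballP[r /= r0 hr] : \forall s \near (0 : R),
    (1 + s) `^ (2 * b) * F (x2, (1 + s) * t) < F (x1, t) by exact: (cvgr_lt _ cv _ neg).
have r2 : 0 < r / 2 by rewrite divr_gt0.
have := hr (r / 2); rewrite /ball /= sub0r normrN gtr0_norm //.
rewrite ltr_pdivrMr // ltr_pMr // ltr1n => /(_ isT).
by rewrite ltNge ray.
Qed.

Lemma horizontal_invariance (x1 x2 : 'rV[R]_k) (t : R) : 0 <= t -> F (x1, t) = F (x2, t).
Proof.
have int s : 0 < s -> F (x1, s) = F (x2, s).
  by move=> s0; apply/eqP; rewrite eq_le !horizontal_le.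
rewrite le_eqVlt => /predU1P[<-|]; last exact: int.
apply/eqP; rewrite -subr_eq0; apply/negP => /negP ne.
have pc (x : 'rV[R]_k) : F (x, s) @[s --> (0 : R)] --> F (x, 0).
  suff tc : (x, s) @[s --> (0 : R)] --> (x, 0).
    exact: (cvg_comp _ _ tc (sol_cont sol (x, 0))).
  apply: cvg_pt => -[i|] /=; first exact: cvg_cst.
  exact: cvg_id.
have cv : `|F (x1, s) - F (x2, s)| @[s --> (0 : R)] --> `|F (x1, 0) - F (x2, 0)|.
  by apply: cvg_norm; apply: cvgB.
have n0 : 0 < `|F (x1, 0) - F (x2, 0)| by rewrite normr_gt0.
have /nbhs_ballP[r /= r0 hr] : \forall s \near (0 : R), 0 < `|F (x1, s) - F (x2, s)|.
  exact: (cvgr_gt _ cv _ n0).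
have r2 : 0 < r / 2 by rewrite divr_gt0.
have := hr (r / 2); rewrite /ball /= sub0r normrN (gtr0_norm r2).
rewrite ltr_pdivrMr // ltr_pMr // ltr1n => /(_ isT).
by rewrite (int _ r2) subrr normr0 ltxx.
Qed.

Lemma profile_deriv (x : 'rV[R]_k) (t : R) : 0 < t ->
  is_derive t 1 (fun t => F (x, t)) (G None (x, t)).
Proof.
move=> t0; apply/is_derive_shift0.
have := sol_grad sol (x, t) t0 None; congr is_derive; apply/funext => s; congr F.
apply: ptP => d; rewrite pcoordD pcoordZ pcoord_dirv; case: d => [i|] /=.
  by rewrite mulr0 addr0.
by rewrite mulr1.
Qed.

(** By [horizontal_invariance] the horizontal derivatives vanish, and only the vertical second
    derivative remains in the equation. *)
Lemma profile_deriv2 (x : 'rV[R]_k) (t : R) : 0 < t ->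
  is_derive t 1 (fun t => G None (x, t)) (K * F (x, t) `^ p).
Proof.
move=> t0.
have lineE (i : 'I_k) y (s : R) : 0 < y.2 -> F (y + s *: dirv (Some i)) = F y.
  move=> y2; have := snd_line y (Some i) s; rewrite mulr0 addr0.
  case: (y + _) => x1 t1 /= ->; case: y y2 => x2 t2 /= t20.
  by apply: horizontal_invariance; exact: ltW.
have G0 (i : 'I_k) y : 0 < y.2 -> G (Some i) y = 0.
  move=> y2; have [_ dv] := sol_grad sol y y2 (Some i); rewrite -dv.
  rewrite (_ : (fun s => _) = cst (F y)); first exact: derive_cst.
  by apply/funext => s; rewrite lineE.
have H0 (i : 'I_k) y : 0 < y.2 -> H (Some i) (Some i) y = 0.
  move=> y2; have [_ dv] := sol_hess sol (Some i) y y2 (Some i); rewrite -dv.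
  rewrite (_ : (fun s => _) = cst 0); first exact: derive_cst.
  apply/funext => s; apply: G0.
  by have := snd_line y (Some i) s; rewrite mulr0 addr0 => ->.
have y2 : 0 < (x, t).2 by [].
rewrite -(sol_pde sol (x, t)) // (bigD1 None) //= big1 ?addr0; last first.
  by case=> // i _; exact: H0.
apply/is_derive_shift0.
have := sol_hess sol None (x, t) t0 None; congr is_derive; apply/funext => s; congr G.
apply: ptP => d; rewrite pcoordD pcoordZ pcoord_dirv; case: d => [i|] /=.
  by rewrite mulr0 addr0.
by rewrite mulr1.
Qed.

End Symmetry.

(** * The ordinary differential equation on the half line *)

Section Profile.
Context {R : realType}.
Variables (f g : R -> R) (K p q c A : R).
Hypotheses (fc : continuous f) (gc : continuous g).
Hypotheses (df : forall t : R, 0 < t -> is_derive t 1 f (g t)).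
Hypotheses (dg : forall t : R, 0 < t -> is_derive t 1 g (K * f t `^ p)).
Hypotheses (f_gt0 : forall t, 0 <= t -> 0 < f t) (g0 : g 0 = - c * f 0 `^ q).
Hypotheses (K0 : 0 < K) (p1 : 1 < p) (c0 : 0 < c) (q_lt : 2 * q < p + 1).
Hypotheses (A0 : 0 < A) (A2 : A ^+ 2 * (p + 1) = 2 * K).

Let mvt (h dh : R -> R) (s t : R) : 0 <= s -> s < t ->
  (forall x : R, 0 < x -> is_derive x 1 h (dh x)) -> (forall x, 0 <= x -> {for x, continuous h}) ->
  exists x, [/\ 0 < x, s < x, x < t & h t - h s = dh x * (t - s)].
Proof.
move=> s0 st d cont.
have d' x : x \in `]s, t[%R -> is_derive (x : R) 1 h (dh x).
  by rewrite in_itv /= => /andP[sx _]; apply: d; exact: le_lt_trans sx.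
have cont' : {within `[s, t], continuous h}.
  apply: continuous_in_subspaceT => x; rewrite inE /= in_itv /= => /andP[sx _].
  by apply: cont; exact: le_trans sx.
have [x] := MVT st d' cont'.
by rewrite in_itv /= => /andP[sx xt] E; exists x; split => //; exact: le_lt_trans sx.
Qed.

Let der_powR (a t : R) : 0 < t -> is_derive t 1 (fun t => f t `^ a) (a * f t `^ (a - 1) * g t).
Proof.
move=> t0; have f0 := f_gt0 t (ltW t0).
exact: is_derive1_comp (is_derive1_powR a f0) (df t t0).
Qed.

Let powR_cont (a t : R) : 0 <= t -> {for t, continuous (fun t => f t `^ a)}.
Proof.
by move=> t0; exact: (cvg_comp _ _ (fc t) (powR_continuous a _ (f_gt0 t t0))).
Qed.

Let g_incr s t : 0 <= s -> s < t -> g s < g t.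
Proof.
move=> s0 st; have [x [x0 _ _ E]] := mvt g _ s t s0 st dg (fun x _ => gc x).
by rewrite -subr_gt0 E !mulr_gt0 ?subr_gt0 ?powR_gt0 ?f_gt0 // ltW.
Qed.

Let f_half t : 0 <= t -> (f t `^ ((p + 1) / 2)) ^+ 2 = f t `^ (p + 1).
Proof. by move=> t0; rewrite -powR_mulrn ?powR_ge0 // -powRrM divfK // gt_eqF. Qed.

(** Multiply [f'' = K f ^ p] by [2 f']; here [A ^+ 2 = 2 * K / (p + 1)]. *)
Let energy_const t : 0 <= t ->
  g t ^+ 2 - A ^+ 2 * f t `^ (p + 1) = g 0 ^+ 2 - A ^+ 2 * f 0 `^ (p + 1).
Proof.
rewrite le_eqVlt => /predU1P[<-//|t0].
have dE (x : R) : 0 < x -> is_derive x 1 (fun t => g t * g t - A ^+ 2 * f t `^ (p + 1)) 0.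
  move=> x0; apply: der_eq (derB (derM (dg x x0) (dg x x0)) (derZ (A ^+ 2) (der_powR (p + 1) x x0))) _.
  rewrite addrK (_ : A ^+ 2 * _ = A ^+ 2 * (p + 1) * (f x `^ p * g x)); last by ring.
  by rewrite A2; ring.
have cE (x : R) : 0 <= x -> {for x, continuous (fun t => g t * g t - A ^+ 2 * f t `^ (p + 1))}.
  move=> x0; apply: cvgB; first by apply: cvgM; exact: gc.
  by apply: cvgM; [exact: cvg_cst | exact: powR_cont].
have [x [_ _ _ E]] := mvt _ _ 0 t (lexx 0) t0 dE cE.
by apply/eqP; rewrite !expr2 -subr_eq0 -expr2 E mul0r.
Qed.

(** The power of [f] that makes [f' = - A f ^ ((p + 1) / 2)] linear: along it [phi] has the constant
    slope [(p - 1) / 2 * A]. *)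
Let phi t : R := f t `^ (- ((p - 1) / 2)).

Let phi_gt0 t : 0 <= t -> 0 < phi t.
Proof. by move=> t0; rewrite powR_gt0 // f_gt0. Qed.

Let dphi (t : R) : 0 < t ->
  is_derive t 1 phi (- ((p - 1) / 2) * (g t / f t `^ ((p + 1) / 2))).
Proof.
move=> t0; apply: der_eq (der_powR _ t t0) _.
rewrite (_ : - ((p - 1) / 2) - 1 = - ((p + 1) / 2)); last by field.
by rewrite powRN; ring.
Qed.

Let p1_gt0 : 0 < (p - 1) / 2.
Proof. by rewrite divr_gt0 // subr_gt0. Qed.

(** Otherwise [f] blows up in finite time: after [t1] one has [f' >= kap * f ^ ((p + 1) / 2)], so
    the positive function [phi] decreases at least linearly. *)
Let g_le0 t1 : 0 <= t1 -> g t1 <= 0.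
Proof.
move=> t10; rewrite leNgt; apply/negP => g1.
pose h t := f t `^ ((p + 1) / 2).
have h_gt0 t : 0 <= t -> 0 < h t by move=> ?; rewrite powR_gt0 // f_gt0.
(* [kap * h t1 <= g t1] starts the inequality at [t1], and [kap <= A] lets the energy identity
   propagate it. *)
have [kap [kap0 kA kg]] : exists kap, [/\ 0 < kap, kap <= A & kap * h t1 <= g t1].
  exists (Num.min A (g t1 / h t1)); rewrite lt_min A0 divr_gt0 ?h_gt0 // ge_min lexx.
  by split => //; rewrite -ler_pdivlMr ?h_gt0 // ge_min lexx orbT.
have f_incr t : t1 < t -> f t1 <= f t.
  move=> tt; have [x [x0 x1 _ E]] := mvt f _ t1 t t10 tt df (fun x _ => fc x).
  rewrite -subr_ge0 E mulr_ge0 ?subr_ge0 ?(ltW tt) //.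
  by rewrite ltW // (lt_trans g1) // g_incr.
have slope t : t1 < t -> kap * h t <= g t.
  move=> tt; have t0 := le_lt_trans t10 tt.
  have gt0 : 0 < g t by apply: lt_trans g1 _; exact: g_incr.
  have ht := h_gt0 t (ltW t0); have ht1 := h_gt0 t1 t10.
  rewrite -(@ler_pXn2r _ 2) ?nnegrE ?(ltW gt0) ?mulr_ge0 ?(ltW kap0) ?(ltW ht) //.
  have hh : h t1 <= h t.
    apply: ge0_ler_powR; rewrite ?nnegrE ?(ltW (f_gt0 _ _)) ?(ltW t0) ?f_incr //.
    by rewrite divr_ge0 // addr_ge0 // ltW // (lt_trans ltr01).
  have e1 := energy_const t (ltW t0); have e2 := energy_const t1 t10.
  rewrite -f_half ?(ltW t0) // -/(h t) in e1; rewrite -f_half // -/(h t1) in e2.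
  have : 0 <= (A ^+ 2 - kap ^+ 2) * (h t ^+ 2 - h t1 ^+ 2).
    by rewrite mulr_ge0 // subr_ge0 ler_pXn2r ?nnegrE ?(ltW kap0) ?(ltW A0) ?(ltW ht) ?(ltW ht1).
  have : kap ^+ 2 * h t1 ^+ 2 <= g t1 ^+ 2.
    by rewrite -exprMn ler_pXn2r ?nnegrE ?(ltW g1) ?mulr_ge0 ?(ltW kap0) ?(ltW ht1).
  move: e1 e2; rewrite exprMn.
  move: (g 0 ^+ 2 - _) => e0.
  move: (A ^+ 2) (kap ^+ 2) (h t ^+ 2) (h t1 ^+ 2) (g t ^+ 2) (g t1 ^+ 2) => a k u u1 w w1.
  rewrite mulrBl !mulrBr; lra.
have ph1 := phi_gt0 t1 t10.
have den : 0 < (p - 1) / 2 * kap by rewrite mulr_gt0.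
(* The time at which the linear upper bound for [phi] reaches [0]. *)
pose t := t1 + phi t1 / ((p - 1) / 2 * kap).
have tt : t1 < t by rewrite ltrDl divr_gt0.
have t0 := le_lt_trans t10 tt.
have [x [x0 tx _ E]] := mvt phi _ t1 t t10 tt dphi (fun x x0 => powR_cont _ x x0).
have bound : kap <= g x / h x by rewrite ler_pdivlMr ?h_gt0 ?slope // ltW.
have : phi t - phi t1 <= - ((p - 1) / 2) * kap * (t - t1).
  by rewrite E ler_pM2r ?subr_gt0 // -/(h x) !mulNr lerN2 ler_pM2l.
rewrite (_ : t - t1 = phi t1 / ((p - 1) / 2 * kap)); last by rewrite /t addrAC subrr add0r.
rewrite !mulNr mulrCA divff ?gt_eqF // mulr1 lerBlDr addNr => h1.
by have := phi_gt0 t (ltW t0); rewrite ltNge h1.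
Qed.

(** A positive [f] cannot descend with slope below [- eps] up to time [f 0 / eps]. *)
Let g_small eps : 0 < eps -> exists2 T, 0 <= T & - eps <= g T.
Proof.
move=> e0; apply: contrapT => /forall2NP hn.
have f00 := f_gt0 0 (lexx 0).
pose t := f 0 / eps.
have t0 : 0 < t by rewrite divr_gt0.
have [x [x0 _ _ E]] := mvt f _ 0 t (lexx 0) t0 df (fun x _ => fc x).
have gx : g x < - eps.
  by case: (hn x) => [/negP|/negP]; [rewrite -ltNge ltNge ltW | rewrite -ltNge].
have : f t - f 0 < - eps * t by rewrite E subr0 ltr_pM2r.
rewrite /t mulNr [eps * _]mulrC divfK ?gt_eqF // ltrBlDr addrC subrr.
by rewrite ltNge ltW // f_gt0 // ltW.
Qed.

(** If [f] stayed above [eps], then [g] would grow at rate at least [K * eps ^ p] and become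
    positive, against [g_le0]. *)
Let f_small eps : 0 < eps -> exists2 T, 0 <= T & f T <= eps.
Proof.
move=> e0; apply: contrapT => /forall2NP hn.
have w0 : 0 < K * eps `^ p by rewrite mulr_gt0 // powR_gt0.
have gneg : 0 <= - g 0 by rewrite oppr_ge0 g_le0.
pose t := (- g 0 + 1) / (K * eps `^ p).
have t0 : 0 < t by rewrite divr_gt0 // ltr_wpDl.
have [x [x0 _ _ E]] := mvt g _ 0 t (lexx 0) t0 dg (fun x _ => gc x).
have fx : eps < f x.
  by case: (hn x) => [/negP|/negP]; [rewrite -ltNge ltNge ltW | rewrite -ltNge].
have : K * eps `^ p * t <= g t - g 0.
  rewrite E subr0 ler_pM2r // ler_pM2l //.
  have p0 : 0 <= p by rewrite ltW // (lt_trans ltr01).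
  have fx0 := f_gt0 x (ltW x0).
  by apply: ge0_ler_powR; rewrite ?nnegrE ?(ltW e0) ?(ltW fx0) ?(ltW fx).
rewrite /t mulrC divfK ?gt_eqF // lerBrDr addrAC addNr add0r => h1.
by have := g_le0 t (ltW t0); rewrite leNgt (lt_le_trans ltr01 h1).
Qed.

(* The energy is the limit at infinity, where both [f] and [f'] vanish. *)
Let energy0 : g 0 ^+ 2 - A ^+ 2 * f 0 `^ (p + 1) = 0.
Proof.
set e := _ - _; apply/eqP; rewrite -normr_eq0 eq_le normr_ge0 andbT.
apply/ler_addgt0Pr => del del0; rewrite add0r.
have w0 : 0 < 1 + A ^+ 2 by rewrite ltr_wpDr // sqr_ge0.
have [eps [e0 e1 e2]] : exists eps, [/\ 0 < eps, eps <= 1 & eps * (1 + A ^+ 2) <= del].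
  exists (Num.min 1 (del / (1 + A ^+ 2))); rewrite lt_min ltr01 divr_gt0 // ge_min lexx.
  by split => //; rewrite -ler_pdivlMr // ge_min lexx orbT.
have [T1 T10 gT1] := g_small eps e0; have [T2 T20 fT2] := f_small eps e0.
pose T := Num.max T1 T2.
have T0 : 0 <= T by rewrite le_max T10.
have gT : - eps <= g T.
  have : T1 <= T by rewrite le_max lexx.
  rewrite le_eqVlt => /predU1P[<-//|h]; apply: le_trans gT1 _.
  by rewrite ltW // g_incr.
have fT : f T <= eps.
  have : T2 <= T by rewrite le_max lexx orbT.
  rewrite le_eqVlt => /predU1P[<-//|h]; apply: le_trans fT2.
  have [x [x0 _ _ E]] := mvt f _ T2 T T20 h df (fun x _ => fc x).
  by rewrite -subr_le0 E mulr_le0_ge0 ?subr_ge0 ?(ltW h) // g_le0 // ltW.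
rewrite /e -(energy_const T T0); apply: le_trans e2.
have i1 : g T ^+ 2 <= eps.
  apply: (@le_trans _ _ (eps ^+ 2)); last by rewrite expr2 ler_piMl // ltW.
  by rewrite -sqrrN ler_pXn2r ?nnegrE ?oppr_ge0 ?g_le0 ?(ltW e0) // lerNl.
have i2 : f T `^ (p + 1) <= eps.
  apply: (le_trans _ fT); apply: ge1r_powR; first by rewrite f_gt0 // (le_trans fT).
  by rewrite lerDr ltW // (lt_trans ltr01).
have i3 : A ^+ 2 * f T `^ (p + 1) <= A ^+ 2 * eps by rewrite ler_wpM2l // sqr_ge0.
have i4 : 0 <= A ^+ 2 * f T `^ (p + 1) by rewrite mulr_ge0 ?sqr_ge0 ?powR_ge0.
have i5 : 0 <= A ^+ 2 * eps by rewrite mulr_ge0 ?sqr_ge0 ?ltW.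
have i6 := sqr_ge0 (g T).
move: i1 i3 i4 i5 i6 (ltW e0); rewrite mulrDr mulr1 [eps * _]mulrC.
move: (A ^+ 2 * eps) (A ^+ 2 * f T `^ (p + 1)) (g T ^+ 2) => u1 u2 u3 *.
by rewrite ler_norml; apply/andP; split; lra.
Qed.

(** Zero energy determines [g] up to sign, and [g_le0] selects the decreasing branch. *)
Lemma first_order t : 0 <= t -> g t = - (A * f t `^ ((p + 1) / 2)).
Proof.
move=> t0; have := energy_const t t0; rewrite energy0 -f_half // -exprMn => /eqP.
rewrite subr_eq0 -sqrrN => E; apply/eqP; rewrite -eqr_oppLR; move: E.
by rewrite eqrXn2 ?oppr_ge0 ?g_le0 // mulr_ge0 ?powR_ge0 // ltW.
Qed.

Lemma profile_formula t : 0 <= t ->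
  f t = ((p - 1) / 2 * A * t + (c^-1 * A) `^ (- (p - 1) / (2 * q - p - 1))) `^ (- 2 / (p - 1)).
Proof.
move=> t0; have f00 := f_gt0 0 (lexx 0).
have p1' : p - 1 != 0 by rewrite gt_eqF // subr_gt0.
have q' : 2 * q - p - 1 != 0 by rewrite lt_eqF // -addrA -opprD subr_lt0.
(* The boundary condition and [first_order] at [0] give [c * f 0 ^ q = A * f 0 ^ ((p + 1) / 2)],
   which determines [f 0] because [2 * q] differs from [p + 1]. *)
have f0E : c^-1 * A = f 0 `^ ((2 * q - p - 1) / 2).
  have := first_order 0 (lexx 0); rewrite g0 mulNr => /oppr_inj h.
  have -> : (2 * q - p - 1) / 2 = q - (p + 1) / 2 by field.
  rewrite powRB ?(gt_eqF f00) ?implybT //.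
  apply: (mulfI (lt0r_neq0 c0)); rewrite mulVKf ?gt_eqF //.
  by rewrite mulrA h mulfK // gt_eqF // powR_gt0.
have -> : (c^-1 * A) `^ (- (p - 1) / (2 * q - p - 1)) = phi 0.
  by rewrite f0E -powRrM /phi; congr (_ `^ _); field; rewrite q'.
have phiE : phi t = (p - 1) / 2 * A * t + phi 0.
  move: t0; rewrite le_eqVlt => /predU1P[<-|t0]; first by rewrite mulr0 add0r.
  have [x [x0 _ _ E]] := mvt phi _ 0 t (lexx 0) t0 dphi (fun x x0 => powR_cont _ x x0).
  have gx : g x / f x `^ ((p + 1) / 2) = - A.
    rewrite first_order; last exact: ltW.
    by rewrite mulNr mulfK // gt_eqF // powR_gt0 // f_gt0 // ltW.
  by move: E; rewrite gx subr0 mulrNN => <-; rewrite subrK.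
rewrite -phiE /phi -powRrM (_ : _ * _ = 1) ?powRr1 ?ltW ?f_gt0 //.
by field; rewrite p1'.
Qed.

End Profile.

(** * Classical solutions *)

Section ClassicalSolution.
Context {R : realType} {k : nat}.
Local Notation X := ('rV[R]_k * R)%type.
Local Notation D := (option 'I_k).
Implicit Types (y z : X) (d e : D).

(** Constant continuation below the boundary; since [max] is 1-Lipschitz, continuity within the
    closed half-space becomes continuity everywhere. *)
Definition clamp (f : 'rV[R]_k -> R -> R) (y : X) : R := f y.1 (Num.max y.2 0).

Lemma clampE (f : 'rV[R]_k -> R -> R) y : 0 <= y.2 -> clamp f y = f y.1 y.2.
Proof. by move=> y2; rewrite /clamp max_l. Qed.

Lemma clamp_dist (a b : R) : `|Num.max a 0 - Num.max b 0| <= `|a - b|.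
Proof.
case: (leP 0 a) => ha; case: (leP 0 b) => hb.
- by [].
- rewrite subr0 ger0_norm // ger0_norm; lra.
- rewrite sub0r normrN ger0_norm // ler0_norm; lra.
- by rewrite subrr normr0.
Qed.

Lemma clamp_continuous (f : 'rV[R]_k -> R -> R) :
  {within Hclos k, continuous uncurry2 f} -> continuous (clamp f).
Proof.
move=> /subspace_continuousP fc y.
have y'0 : Hclos k (y.1, Num.max y.2 0) by rewrite /Hclos /= le_max lexx orbT.
move=> B /(fc _ y'0); rewrite /= => /nbhs_pt [e e0 he].
apply/nbhs_pt; exists e => // z hz; apply: (he (z.1, Num.max z.2 0)).
  move=> [i|] /=; first exact: (hz (Some i)).
  exact: le_lt_trans (clamp_dist _ _) (hz None).
by rewrite /Hclos /= le_max lexx orbT.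
Qed.

Lemma half_continuous (f : 'rV[R]_k -> R -> R) y :
  {within Hhalf k, continuous uncurry2 f} -> 0 < y.2 -> {for y, continuous (uncurry2 f)}.
Proof.
move=> /subspace_continuousP fc y2 B /(fc y y2); rewrite /= => /nbhs_pt [e e0 he].
have /nbhs_pt [e' e'0 he'] : \forall z \near y, 0 < z.2 by exact: snd_near.
apply/nbhs_pt; exists (Num.min e e'); first by rewrite lt_min e0.
move=> z hz; apply: (he z); first by move=> d; have := hz d; rewrite lt_min => /andP[].
by apply: he' => d; have := hz d; rewrite lt_min => /andP[].
Qed.

Lemma shiftE (f : 'rV[R]_k -> R -> R) d y (s : R) :
  Defs.shift f d y.1 y.2 s = uncurry2 f (y + s *: dirv d).
Proof.
rewrite /uncurry2 snd_line; case: d => [i|] /=.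
  rewrite mulr0 addr0; congr (f _ _); apply/rowP => j.
  by rewrite !mxE eqxx /= [Some j == _](inj_eq Some_inj).
rewrite mulr1; congr (f _ _); apply/rowP => j.
by rewrite !mxE /= mulr0 addr0.
Qed.

Lemma line_near_pos y d : 0 < y.2 -> \forall s \near (0 : R), 0 < (y + s *: dirv d).2.
Proof. by move=> y2; exact: line_cvg0 y d _ (snd_near y y2). Qed.

Lemma derivable_shift_is_derive (f : 'rV[R]_k -> R -> R) (h : X -> R) d y : 0 < y.2 ->
  derivable (Defs.shift f d y.1 y.2) 0 1 -> (forall z, 0 < z.2 -> f z.1 z.2 = h z) ->
  is_derive (0 : R) 1 (fun s => h (y + s *: dirv d)) (partial d f y.1 y.2).
Proof.
move=> y2 fd fh; apply: (@near_eq_is_derive _ _ _ (Defs.shift f d y.1 y.2)).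
  near=> s; rewrite shiftE /uncurry2 fh //; near: s; exact: line_near_pos.
by rewrite /partial derive1E; exact: derivableP.
Unshelve. all: by end_near. Qed.

Variables (K p q c : R) (u : 'rV[R]_k -> R -> R).
Hypotheses (K0 : 0 < K) (p1 : 1 <= p) (q0 : q != 0).
Hypotheses (u2 : C2_H u) (u1 : C1_Hbar u).
Hypothesis pde : forall x t, 0 < t -> laplacian u x t = K * u x t `^ p.
Hypothesis pos : forall x t, 0 < t -> 0 < u x t.
Hypothesis bd : forall x, (fun h => (u x h - u x 0) / h) @ 0^'+ --> - c * u x 0 `^ q.

Lemma classical_halfspace_solution : exists G H, halfspace_solution K p q c (clamp u) G H.
Proof.
have [uc ug] := u1; have [_ uH] := u2.
have /choice [g hg] : forall d, exists g : 'rV[R]_k -> R -> R,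
    {within Hclos k, continuous uncurry2 g} /\ (forall x t, 0 < t -> partial d u x t = g x t).
  by move=> d; have [_] := ug d.
pose G d := clamp (g d); pose H d e := uncurry2 (partial e (partial d u)).
have Fc := clamp_continuous u uc.
have Gc d : continuous (G d) by exact: clamp_continuous (hg d).1.
have FG : has_grad (clamp u) G.
  move=> y y2 d; rewrite /G clampE ?(ltW y2) // -(hg d).2 //.
  apply: derivable_shift_is_derive => //; first by have [h _] := ug d; exact: h.
  by move=> z z2; rewrite clampE // ltW.
have GH d : has_grad (G d) (H d).
  move=> y y2 e; apply: derivable_shift_is_derive => //.
    by have [h _] := uH d e; have [] := h y.1 y.2 y2.
  by move=> z z2; rewrite (hg d).2 // /G clampE // ltW.
have Hc d e y : 0 < y.2 -> {for y, continuous (H d e)}.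
  by move=> y2; apply: half_continuous => //; have [_ []] := uH d e.
have Fpde y : 0 < y.2 -> \sum_d H d d y = K * clamp u y `^ p.
  by move=> y2; rewrite clampE ?ltW // -pde.
have Fpos y : 0 < y.2 -> 0 < clamp u y by move=> y2; rewrite clampE ?ltW // pos.
have upc (x : 'rV[R]_k) (t0 : R) : (x, t) @[t --> t0] --> (x, t0).
  by apply: cvg_pt => -[i|] /=; [exact: cvg_cst | exact: cvg_id].
have Fge0 y : y.2 = 0 -> 0 <= clamp u y.
  move=> y2; rewrite leNgt; apply/negP => neg.
  have /nbhs_ballP[r /= r0 hr] : \forall t \near (0 : R), clamp u (y.1, t) < 0.
    rewrite (_ : y = (y.1, 0)) in neg; last by case: (y) y2 => ? ? /= ->.
    exact: (cvgr_lt _ (cvg_comp _ _ (upc y.1 0) (Fc _)) _ neg).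
  have r2 : 0 < r / 2 by rewrite divr_gt0.
  have := hr (r / 2); rewrite /ball /= sub0r normrN gtr0_norm //.
  rewrite ltr_pdivrMr // ltr_pMr // ltr1n => /(_ isT).
  by rewrite ltNge ltW // Fpos.
(* By the mean value theorem the one-sided quotients converge to the continuous extension of the
   normal derivative, which the boundary condition thereby identifies. *)
have quot (x : 'rV[R]_k) : (u x h - u x 0) / h @[h --> 0^'+] --> G None (x, 0).
  apply/cvgrPdist_le => eps e0.
  have cG : G None (x, t) @[t --> (0 : R)] --> G None (x, 0).
    exact: (cvg_comp _ _ (upc x 0) (Gc None _)).
  have /nbhs_ballP[r /= r0 hr] : \forall t \near (0 : R), `|G None (x, 0) - G None (x, t)| <= eps.
    by have /cvgrPdist_le := cG; apply.
  near=> h.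
  have h0 : 0 < h by near: h; exact: nbhs_right_gt.
  have hr' : h < r by near: h; exact: nbhs_right_lt.
  have dF t : t \in `]0, h[%R -> is_derive (t : R) 1 (fun t => clamp u (x, t)) (G None (x, t)).
    rewrite in_itv /= => /andP[t0 _]; apply/is_derive_shift0.
    have := FG (x, t) t0 None; congr is_derive; apply/funext => s; congr clamp.
    apply: ptP => d; rewrite pcoordD pcoordZ pcoord_dirv; case: d => [i|] /=.
      by rewrite mulr0 addr0.
    by rewrite mulr1.
  have cF : {within `[0, h], continuous (fun t => clamp u (x, t))}.
    by apply: continuous_subspaceT => t; exact: (cvg_comp _ _ (upc x t) (Fc _)).
  have [t] := MVT h0 dF cF; rewrite in_itv /= => /andP[t0 th].
  rewrite (clampE u (x, h) (ltW h0)) (clampE u (x, 0) (lexx 0)) /= subr0 => ->.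
  rewrite mulfK ?gt_eqF //.
  by apply: hr; rewrite /ball /= sub0r normrN gtr0_norm // (lt_trans th).
have Gbd y : y.2 = 0 -> G None y = - c * clamp u y `^ q.
  move=> y2; rewrite clampE ?y2 // (_ : y = (y.1, 0)); last by case: (y) y2 => ? ? /= ->.
  exact: (cvg_unique _ (quot y.1) (bd y.1)).
exists G, H; split => // y; rewrite le_eqVlt => /predU1P[y2|]; last exact: Fpos.
have y20 : y.2 = 0 by [].
(* Positivity is given only for [t > 0]. At a boundary zero the boundary condition would make
   [G None] vanish, as [q != 0], while [hopf_bound], translated to that point, keeps the difference
   quotients above some [eps > 0]. *)
rewrite lt_def Fge0 // andbT; apply/negP => /eqP F0.
have FGv := has_grad_translate (clamp u) G y y20 FG.
have GHv d := has_grad_translate (G d) (H d) y y20 (GH d).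
have tE z : (z + y).2 = z.2 by rewrite /= y20 addr0.
have Fcv : continuous (fun z => clamp u (z + y)).
  by move=> z; exact: continuous_translate (Fc (z + y)).
have pdev z : 0 < z.2 -> \sum_d H d d (z + y) = K * clamp u (z + y) `^ p.
  by move=> z2; apply: Fpde; rewrite tE.
have posv z : 0 < z.2 -> 0 < clamp u (z + y) by move=> z2; apply: Fpos; rewrite tE.
have [eps e0 [r r0 hr]] := hopf_bound _ _ _ K p Fcv FGv GHv pdev posv K0 p1.
have small : \forall h \near 0^'+, (u y.1 h - u y.1 0) / h < eps.
  have G0 : G None (y.1, 0) = 0.
    rewrite (_ : (y.1, 0) = y); last by case: (y) y20 => ? ? /= ->.
    by rewrite Gbd // F0 powR0 // mulr0.
  have := quot y.1; rewrite G0 => cq; exact: (cvgr_lt _ cq _ e0).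
near (0 : R)^'+ => h.
have h0 : 0 < h by near: h; exact: nbhs_right_gt.
have hr' : h < r by near: h; exact: nbhs_right_lt.
have : (u y.1 h - u y.1 0) / h < eps by near: h.
have := hr h h0 hr'; rewrite add0r F0 lexx => /(_ isT) hh.
have {hh} : eps * h <= clamp u (h *: dirv None + y).
  by apply: hh => z z2; apply: Fge0; rewrite tE.
have -> : h *: dirv None + y = (y.1, h).
  apply: ptP => d; rewrite pcoordD pcoordZ pcoord_dirv; case: d => [i|] /=.
    by rewrite mulr0 add0r.
  by rewrite mulr1 y20 addr0.
have u0 : u y.1 0 = 0 by move: F0; rewrite clampE y20.
rewrite (clampE u (y.1, h) (ltW h0)) u0 subr0 ltr_pdivrMr //= => h1 h2.
by have := le_lt_trans h1 h2; rewrite ltxx.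
Unshelve. all: by end_near. Qed.

End ClassicalSolution.

Theorem theorem1p1 (R : realType) (n : nat) (p q cplus : R)
  (u : 'rV[R]_(n.-1) -> R -> R) :
  (3 <= n)%N ->
  (n%:R + 2) / (n%:R - 2) <= p ->
  1 <= q -> q < n%:R / (n%:R - 2) ->
  0 < cplus ->
  C2_H u -> C1_Hbar u ->
  (forall x t, 0 < t -> laplacian u x t = n%:R * (n%:R - 2) * u x t `^ p) ->
  (forall x t, 0 < t -> 0 < u x t) ->
  (forall x, (fun h => (u x h - u x 0) / h) @ 0^'+ --> - cplus * u x 0 `^ q) ->
  let A := (2 * n%:R * (n%:R - 2) / (p + 1)) `^ (2^-1) in
  let B := (cplus^-1 * A) `^ (- (p - 1) / (2 * q - p - 1)) in
  forall x t, 0 <= t -> u x t = ((p - 1) / 2 * A * t + B) `^ (- 2 / (p - 1)).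
Proof.
move=> n3 p_ge q1 q_lt c0 uC2 uC1 pde pos bd.
have nm : (n.-1)%:R = n%:R - 1 :> R by rewrite -subn1 natrB // (leq_trans _ n3).
have n3r : 3 <= n%:R :> R by rewrite ler_nat.
move: (n%:R : R) n3r nm p_ge q_lt pde => nr n3r nm p_ge q_lt pde A B x t t0.
have n2 : 0 < nr - 2 by lra.
pose b := (nr - 2) / 4.
have b0 : 0 < b by rewrite divr_gt0.
have kb : (n.-1)%:R = 4 * b + 1 :> R by rewrite nm /b; field.
have K0 : 0 < nr * (nr - 2) by rewrite mulr_gt0 //; lra.
have p_ge' : nr + 2 <= p * (nr - 2) by rewrite -ler_pdivrMr.
have q_lt' : q * (nr - 2) < nr by rewrite -ltr_pdivlMr.
have bp : b + 1 <= b * p.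
  (* With [n - 2 = 4 * b], this is the lower bound on [p] cleared of its denominator; [bq] below is
     the bound on [q]. *)
  by rewrite /b [_ * p]mulrC mulrA ler_pdivlMr // mulrDl divfK // mul1r; lra.
have bq : b * q < b + 2^-1.
  by rewrite /b [_ * q]mulrC mulrA ltr_pdivrMr // mulrDl divfK //; lra.
have p1 : 1 < p.
  by apply: lt_le_trans p_ge; rewrite ltr_pdivlMr //; lra.
(* Both bounds meet at [2 * n / (n - 2)]: it exceeds [2 * q] and is at most [p + 1]. *)
have q2 : 2 * q < p + 1.
  by rewrite -(ltr_pM2r n2) [(p + 1) * _]mulrDl mul1r -mulrA; lra.
have q0 : q != 0 by rewrite gt_eqF // (lt_le_trans ltr01).
have A0 : 0 < A.
  by rewrite powR_gt0 // divr_gt0 ?mulr_gt0 //; lra.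
have A2 : A ^+ 2 * (p + 1) = 2 * (nr * (nr - 2)).
  have w0 : 0 <= 2 * nr * (nr - 2) / (p + 1) by rewrite divr_ge0 ?mulr_ge0 //; lra.
  rewrite -powR_mulrn ?(ltW A0) // -powRrM mulVf // powRr1 // divfK ?mulrA // gt_eqF //; lra.
have [G [H sol]] := classical_halfspace_solution _ p q cplus u K0 (ltW p1) q0 uC2 uC1 pde pos bd.
pose f s := clamp u (x, s); pose g s := G None (x, s).
have xc (s : R) : (x, w) @[w --> s] --> (x, s).
  by apply: cvg_pt => -[i|] /=; [exact: cvg_cst | exact: cvg_id].
have fc : continuous f by move=> s; exact: (cvg_comp _ _ (xc s) (sol_cont sol _)).
have gc : continuous g by move=> s; exact: (cvg_comp _ _ (xc s) (sol_grad_cont sol _ _)).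
have df s : 0 < s -> is_derive (s : R) 1 f (g s) by exact: (profile_deriv _ _ _ _ _ _ _ sol).
have dg s : 0 < s -> is_derive (s : R) 1 g (nr * (nr - 2) * f s `^ p).
  exact: (profile_deriv2 _ _ _ _ _ _ _ b sol kb K0 b0 bp c0 q1 bq).
have f0 s : 0 <= s -> 0 < f s by move=> s0; exact: (sol_pos sol (x, s)).
have g0 : g 0 = - cplus * f 0 `^ q by exact: (sol_bd sol (x, 0)).
have := profile_formula f g _ p q cplus A fc gc df dg f0 g0 K0 p1 c0 q2 A0 A2 t t0.
by rewrite {1}/f clampE.
Qed.
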